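(* For all graphs $G$ and $H$, the Tutte symmetric matrices (infinite matrices indexed by positive integers, defined in the context) satisfy $$M_{G+H}=M_G\,M_H .$$
   Context: $[n]=\{1,\dots,n\}$, $t$ is an indeterminate. A graph is $G=([n],E)$ with $n\ge 1$ and $E$ a set of 2-element subsets of $[n]$. $P_j$ is the path on $[j]$ with edges $\{i,i+1\}$. For $G=([n],E)$ and $H=([n'],E')$, the sum $G+H=([n+n'-1],E\cup\{\{i+n-1,j+n-1\}:\{i,j\}\in E'\})$ glues vertex $n$ of $G$ to vertex $1$ of $H$. $e_n=\sum_{i_1<\cdots<i_n}x_{i_1}\cdots x_{i_n}$ is the elementary symmetric function in $x_1,x_2,\dots$, $e_0=1$, and $e_\lambda=e_{\lambda_1}\cdots e_{\lambda_\ell}$ for a partition $\lambda$. A composition is a finite sequence $\alpha=(\alpha_1,\dots,\alpha_\ell)$ of positive integers; $\ell=\ell(\alpha)$ is its length, $\alpha_\ell$ its last part, its size is the sum of its parts; $\mathrm{sort}(\alpha)$ is the partition obtained by sorting. A component triple of $G$ is $\mathcal C=(C,\alpha,r)$ where $C$ is a connected (not necessarily induced) subgraph of $G$, $\alpha$ is a composition of size $|C|$ (number of vertices), and $1\le r\le\alpha_1$ is an integer. A subgraph triple $\mathcal S$ of $G$ is a collection of component triples $(C_1,\alpha^{(1)},r_1),\dots,(C_m,\alpha^{(m)},r_m)$ such that the disjoint union $C_1\sqcup\cdots\sqcup C_m$ is a spanning subgraph of $G$; the order of listing is immaterial. $\mathrm{ST}(G)$ is the set of subgraph triples. $\mathrm{type}(\mathcal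 S)=\mathrm{sort}(\alpha^{(1)}\cdots\alpha^{(m)})$ (concatenate and sort); $\mathrm{sign}(\mathcal S)=(-1)^{N-\ell(\mathrm{type}(\mathcal S))}$ with $N$ the number of vertices of the graph; $E(\mathcal S)$ is the total number of edges in $C_1,\dots,C_m$; the reduced type $\mathrm{type}'(\mathcal S)$ is $\mathrm{type}(\mathcal S)$ with one instance of $\alpha_1$ removed, where $\alpha$ is the composition of the component containing vertex $1$. For $G=([n],E)$ and $i,j\ge1$, $\mathrm{ST}^{(i)}(G+P_j)$ is the set of $\mathcal S\in\mathrm{ST}(G+P_j)$ such that, with $(C,\alpha,r)$ the component triple with $1\in C$ and $(C',\alpha',r')$ the component triple with $n\in C'$ (possibly the same), one has $\alpha_1=i$, $r=1$, $\{n,n+1,\dots,n+j-1\}\subseteq C'$, and the last part satisfies $\alpha'_\ell\ge j$. The Tutte symmetric matrix $M_G$ has entries $$(M_G)_{i,j}=\sum_{\mathcal S\in\mathrm{ST}^{(i)}(G+P_j)}\mathrm{sign}(\mathcal S)\,(-1)^{1-j}\,t^{E(\mathcal S)+1-j}\,e_{\mathrm{type}'(\mathcal S)},\qquad i,j\ge1.$$ Each column of $M_G$ has finitely many nonzero entries (the entry is $0$ when $i\ge n+j$), so the product is well defined. *)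

(* Defs.v *)
From HB Require Import structures.
From mathcomp Require Import boolp classical_sets functions cardinality fsbigop.
From mathcomp Require Import all_boot all_order all_algebra finmap multiset.

Set Implicit Arguments.
Unset Strict Implicit.
Unset Printing Implicit Defensive.

Import GRing.Theory.

Local Open Scope mset_scope.
Local Open Scope ring_scope.

(* Formal power series with integer coefficients in x_0, x_1, x_2, ...; a
   monomial is the finite multiset of the indices of its variables. *)
Definition series : Type := {mset nat} -> int.

HB.instance Definition _ := gen_eqMixin series.
HB.instance Definition _ := gen_choiceMixin series.

Section SeriesRing.
Implicit Types (f g h : series) (m p q : {mset nat}).

Definition series0 : series := fun=> 0.
Definition series1 : series := fun m => (m == mset0)%:R.
Definition series_add f g : series := fun m => f m + g m.
Definition series_opp f : series := fun m => - f m.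
Definition series_mul f g : series :=
  fun m => \sum_(p \in [set p | (p `<=` m)%mset]%classic) f p * g (m `\` p)%mset.

Lemma series_addA : associative series_add.
Proof. by move=> f g h; apply/funext => m; exact: addrA. Qed.

Lemma series_addC : commutative series_add.
Proof. by move=> f g; apply/funext => m; exact: addrC. Qed.

Lemma series_add0 : left_id series0 series_add.
Proof. by move=> f; apply/funext => m; exact: add0r. Qed.

Lemma series_addN : left_inverse series0 series_opp series_add.
Proof. by move=> f; apply/funext => m; exact: addNr. Qed.

HB.instance Definition _ :=
  GRing.isZmodule.Build series series_addA series_addC series_add0 series_addN.

Lemma finite_msubset m : finite_set [set p | (p `<=` m)%mset]%classic.
Proof.
pose B := \max_(i : finsupp m) m (val i).
pose F (u : {ffun finsupp m -> 'I_B.+1}) : {mset nat} :=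
  [fsfun i : finsupp m => (u i : nat) | 0%N].
apply: (@sub_finite_set _ _ (F @` classical_sets.setT)%classic); last exact: finite_image.
move=> p /= /msubsetP pm; exists [ffun i => inord (p (val i))] => //.
apply/msetP => i; rewrite /F fsfun_ffun; case: insubP => [u iu <- | im].
  rewrite /= ffunE inordK // ltnS (leq_trans (pm _)) //.
  exact: (@leq_bigmax _ (fun j : finsupp m => m (val j)) u).
by move: (pm i); rewrite (fsfun_dflt im) leqn0 => /eqP.
Qed.

Let D m : seq {mset nat} := fset_set [set p | (p `<=` m)%mset]%classic.

Let mem_D m p : (p \in D m) = (p `<=` m)%mset.
Proof. by rewrite /D in_fset_set ?mem_setE //; exact: finite_msubset. Qed.

Let uniq_D m : uniq (D m).
Proof. exact: fset_uniq. Qed.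

Lemma series_mulE f g m : series_mul f g m = \sum_(p <- D m) f p * g (m `\` p)%mset.
Proof. by rewrite /series_mul fsbig_finite //; exact: finite_msubset. Qed.

Lemma series_mulC : commutative series_mul.
Proof.
move=> f g; apply/funext => m; rewrite !series_mulE.
have sub p : (m `\` p `<=` m)%mset by exact: msubsetDl.
rewrite (perm_big [seq (m `\` p)%mset | p <- D m]) /=.
  rewrite big_map big_seq [RHS]big_seq; apply: eq_bigr => p.
  by rewrite mem_D => pm; rewrite msetBBK // mulrC.
apply: uniq_perm => //.
  rewrite map_inj_in_uniq // => p q; rewrite !mem_D => pm qm epq.
  by rewrite -(msetBBK pm) epq msetBBK.
move=> p; rewrite mem_D; apply/idP/mapP => [pm | [q _ ->] //].
by exists (m `\` p)%mset; rewrite ?mem_D // msetBBK.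
Qed.

Lemma series_mul1 : left_id series1 series_mul.
Proof.
move=> f; apply/funext => m; rewrite series_mulE (bigD1_seq mset0) //=.
  rewrite /series1 eqxx mul1r msetB0 big1_seq ?addr0 // => p /andP[/negbTE -> _].
  by rewrite mul0r.
by rewrite mem_D msub0set.
Qed.

Lemma series_mulDl : left_distributive series_mul series_add.
Proof.
move=> f g h; apply/funext => m; rewrite /series_add !series_mulE -big_split /=.
by apply: eq_bigr => p _; rewrite mulrDl.
Qed.

Lemma series_mulA : associative series_mul.
Proof.
move=> f g h; apply/funext => m; rewrite !series_mulE.
have -> : \sum_(p <- D m) f p * series_mul g h (m `\` p)%mset =
    \sum_(p <- D m) \sum_(q <- D m | (p `<=` q)%mset)
       f p * (g (q `\` p)%mset * h (m `\` q)%mset).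
  rewrite big_seq [RHS]big_seq; apply: eq_bigr => p; rewrite mem_D => pm.
  rewrite series_mulE big_distrr /= -[RHS]big_filter.
  rewrite [RHS](perm_big [seq (p `+` q)%mset | q <- D (m `\` p)%mset]) /=.
    rewrite big_map; apply: eq_bigr => q _.
    by rewrite msetDKB msetBDA.
  apply: uniq_perm; first exact: filter_uniq.
    by rewrite map_inj_uniq //; exact: can_inj (msetDKB p).
  move=> q; rewrite mem_filter mem_D; apply/andP/mapP => [[pq qm]|[r]].
    by exists (q `\` p)%mset; rewrite ?mem_D ?msetSB // msetBDKC.
  rewrite mem_D => rm ->; split; first by rewrite -{1}[p]msetD0 msetDS ?msub0set.
  by rewrite -(msetBDKC pm) msetDS.
rewrite (exchange_big_dep xpredT) //= big_seq [RHS]big_seq.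
apply: eq_bigr => q; rewrite mem_D => qm.
rewrite series_mulE big_distrl /= -big_filter.
rewrite (perm_big (D q)); first by apply: eq_bigr => p _; rewrite mulrA.
apply: uniq_perm => //; first exact: filter_uniq.
move=> p; rewrite mem_filter !mem_D andb_idr // => pq.
exact: msubset_trans qm.
Qed.

Lemma series1_neq0 : series1 != 0.
Proof.
by apply/eqP => /(congr1 (@^~ mset0)); rewrite /series1 eqxx => /eqP.
Qed.

HB.instance Definition _ := GRing.Zmodule_isComNzRing.Build series
  series_mulA series_mulC series_mul1 series_mulDl series1_neq0.

End SeriesRing.

(* Coefficientwise: the sum of all products of n distinct variables. *)
Definition elem (n : nat) : series :=
  fun m => (uniq (enum_mset m) && (size (enum_mset m) == n))%:R.

Definition elem_seq (la : seq nat) : series := \prod_(k <- la) elem k.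

Lemma elem0 : elem 0 = 1.
Proof.
apply/funext => m; rewrite /elem; case: eqP => [/eqP | /eqP].
  rewrite size_mset_eq0 => /eqP ->; rewrite enum_mset0 /=.
  by rewrite [RHS]/(series1 _) /series1 eqxx.
by rewrite size_mset_eq0 andbF => /negbTE m0; rewrite [RHS]/(series1 _) /series1 m0.
Qed.

(* A [graph p] has p + 1 vertices, so that graphs are nonempty and the sum has
   type [graph (p + q)].  Vertices are numbered from 0: the vertex v of
   {1, ..., p + 1} is the ordinal of value v - 1. *)
Record graph (p : nat) := Graph {
  edges : {set {set 'I_p.+1}};
  edges_card : [forall e in edges, #|e| == 2%N] }.

Definition path_edges (p : nat) : {set {set 'I_p.+1}} :=
  [set [set x.1; x.2] | x : 'I_p.+1 * 'I_p.+1 & x.2 == x.1.+1 :> nat].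

Lemma path_edges_card p : [forall e in path_edges p, #|e| == 2%N].
Proof.
apply/forall_inP => _ /imsetP[[i j] /= + ->]; rewrite inE cards2 /= => /eqP ij.
by rewrite -val_eqE /= ij neq_ltn ltnSn.
Qed.

Definition path_graph (p : nat) : graph p := Graph (path_edges_card p).

Section Sum.
Variables p q : nat.

Definition sum_lvertex (i : 'I_p.+1) : 'I_(p + q).+1 := inord i.
Definition sum_rvertex (j : 'I_q.+1) : 'I_(p + q).+1 := inord (j + p).

Lemma sum_lvertexE i : sum_lvertex i = i :> nat.
Proof. by rewrite inordK // ltnS (leq_trans (leq_ord i)) ?leq_addr. Qed.

Lemma sum_rvertexE j : sum_rvertex j = (j + p)%N :> nat.
Proof. by rewrite inordK // ltnS addnC leq_add2l leq_ord. Qed.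

Variables (G : graph p) (H : graph q).

Definition sum_edges : {set {set 'I_(p + q).+1}} :=
  ([set sum_lvertex @: (e : {set 'I_p.+1}) | e in edges G]
    :|: [set sum_rvertex @: (e : {set 'I_q.+1}) | e in edges H])%SET.

Lemma sum_edges_card : [forall e in sum_edges, #|e| == 2%N].
Proof.
apply/forall_inP => e; rewrite inE => /orP[] /imsetP[d dE ->].
  rewrite card_imset ?(forall_inP (edges_card G)) // => i j /(congr1 val) /=.
  by rewrite !sum_lvertexE => /val_inj.
rewrite card_imset ?(forall_inP (edges_card H)) // => i j /(congr1 val) /=.
by rewrite !sum_rvertexE => /addIn /val_inj.
Qed.

Definition sum_graph : graph (p + q) := Graph sum_edges_card.

End Sum.

Definition is_comp_of (n : nat) (a : seq nat) : bool :=
  all (leq 1) a && (sumn a == n).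

(* The component triple (C, alpha, r).  The bounds on alpha and r only serve to
   make the type finite: a composition of |C| <= p + 1 has at most p + 1 parts,
   each at most p + 1. *)
Record comp_triple (p : nat) := CompTriple {
  ct_verts : {set 'I_p.+1};
  ct_edges : {set {set 'I_p.+1}};
  ct_parts : {bseq p.+1 of 'I_p.+2};
  ct_root : 'I_p.+2 }.

Definition comp_triple_to_prod p (c : comp_triple p) :=
  (ct_verts c, ct_edges c, ct_parts c, ct_root c).

Definition prod_to_comp_triple p
    (x : {set 'I_p.+1} * {set {set 'I_p.+1}} * {bseq p.+1 of 'I_p.+2} * 'I_p.+2) :=
  CompTriple x.1.1.1 x.1.1.2 x.1.2 x.2.

Lemma comp_triple_to_prodK p :
  cancel (@comp_triple_to_prod p) (@prod_to_comp_triple p).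
Proof. by case. Qed.

HB.instance Definition _ p :=
  Finite.copy (comp_triple p) (can_type (@comp_triple_to_prodK p)).

Definition ct_comp p (c : comp_triple p) : seq nat := map val (ct_parts c).

Section SubgraphTriples.
Variables (p : nat) (G : graph p).
Implicit Types (c d : comp_triple p) (S : {set comp_triple p}).

Definition is_connected_subgraph (V : {set 'I_p.+1}) (E : {set {set 'I_p.+1}}) :=
  [&& V != set0, E \subset edges G, [forall e in E, (e : {set 'I_p.+1}) \subset V]
    & [forall u in V, [forall v in V,
        connect (fun x y : 'I_p.+1 => [set x; y]%SET \in E) u v]]].

Definition is_comp_triple c :=
  [&& is_connected_subgraph (ct_verts c) (ct_edges c),
      is_comp_of #|ct_verts c| (ct_comp c)
    & (1 <= ct_root c <= head 0 (ct_comp c))%N].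

(* Components being nonempty and pairwise disjoint, a collection of component
   triples has no repetition and is a set. *)
Definition subgraph_triples : {set {set comp_triple p}} :=
  [set S : {set comp_triple p} |
    [&& [forall c in S, is_comp_triple c],
        [forall c in S, [forall d in S,
          (c != d) ==> [disjoint ct_verts c & ct_verts d]]]
      & (\bigcup_(c in S) ct_verts c)%SET == [set: 'I_p.+1]%SET]]%SET.

End SubgraphTriples.

Section Statistics.
Variable p : nat.
Implicit Types (S : {set comp_triple p}) (v : 'I_p.+1).

Definition st_type S : seq nat :=
  sort geq (flatten [seq ct_comp c | c <- enum S]).

Definition st_sign S : int := (-1) ^+ (p.+1 - size (st_type S)).

Definition st_edges S : nat := (\sum_(c in S) #|ct_edges c|)%N.

(* The component triple whose component contains v; the default value is never
   reached on a subgraph triple, since its components cover all vertices. *)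
Definition comp_at S v : comp_triple p :=
  odflt (CompTriple set0 set0 [bseq] ord0)
    [pick c in S | v \in ct_verts c].

Definition st_rtype S : seq nat :=
  rem (head 0%N (ct_comp (comp_at S ord0))) (st_type S).

End Statistics.

Section TutteMatrix.
Variables (p : nat) (G : graph p).

(* ST^(i)(G + P_j) for i, j >= 1; P_j is [path_graph j.-1], the last vertex n
   of G has value p, and the path part {n, ..., n+j-1} consists of the vertices
   of value at least p. *)
Definition restricted_triples (i j : nat) : {set {set comp_triple (p + j.-1)}} :=
  [set S in subgraph_triples (sum_graph G (path_graph j.-1)) |
    let c := comp_at S ord0 in
    let c' := comp_at S (inord p) in
    [&& head 0 (ct_comp c) == i, ct_root c == 1 :> nat,
        [forall v : 'I_(p + j.-1).+1, (p <= v) ==> (v \in ct_verts c')]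
      & j <= last 0 (ct_comp c')]%N]%SET.

Definition Tutte_entry (i j : nat) : {poly series} :=
  \sum_(S in restricted_triples i j)
    (st_sign S)%:~R * (-1) ^+ j.-1 * 'X^(st_edges S - j.-1)
      * (elem_seq (st_rtype S))%:P.

(* Infinite matrices are indexed from 0: row i and column j of [Tutte_mx] are
   row i + 1 and column j + 1 of M_G.  The exponents 1 - j of -1 and
   E(S) + 1 - j of t are written j.-1 and E(S) - j.-1; the latter subtraction is
   never truncated, since a connected C' containing the path contains its
   j - 1 edges. *)
Definition Tutte_mx : nat -> nat -> {poly series} :=
  fun i j => Tutte_entry i.+1 j.+1.

Lemma Tutte_mx_eq0 i j : (p + j < i)%N -> Tutte_mx i j = 0.
Proof.
move=> ltpi; rewrite /Tutte_mx /Tutte_entry big1 // => S.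
rewrite inE => /andP[_ /and4P[/eqP hi _ _ _]]; exfalso.
move: hi; rewrite /ct_comp; case: (ct_parts _) => -[//|a s] /= _ ai.
by have := ltn_ord a; rewrite ai !ltnS leqNgt ltpi.
Qed.

End TutteMatrix.

(* [\sum_(k \in A)] is the sum over the finitely many nonzero terms. *)
Definition infmx_mul (R : pzRingType) (A B : nat -> nat -> R) : nat -> nat -> R :=
  fun i j => \sum_(k \in [set: nat]%classic) A i k * B k j.

(* Main.v *)
Require Import Defs.
From mathcomp Require Import boolp classical_sets functions cardinality fsbigop.
From mathcomp Require Import all_boot all_order all_algebra finmap multiset.
From mathcomp Require Import zify ring.

(* All the statistics in an entry of M_G are products over the component
   triples of S, so the entry is a sum over set partitions of the vertices, of
   products of block weights.  Write n for the glued vertex.  Expanding both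
   sides along the block B containing n, the other blocks lie on one side of n
   and contribute the same factors to M_{G+H} and to M_G M_H.  The block B
   meets the two sides in sets of sizes a and b; connected subgraphs on B are
   pairs of connected subgraphs on the two parts.  What is left is a bijection
   between compositions gamma of a + b - 1 and pairs (alpha, beta), where beta
   is a composition of b, alpha one of a + beta_1 - 1 with last part at least
   beta_1, and gamma is alpha followed by beta without its first part: alpha is
   the shortest prefix of gamma with sum at least a. The summation index k of
   the matrix product is beta_1. *)

Set Implicit Arguments.
Unset Strict Implicit.
Unset Printing Implicit Defensive.

Import GRing.Theory.

Local Open Scope ring_scope.

(* Stated over an abstract ring: [ring] does not terminate in reasonable time
   on [{poly series}]. *)
Lemma mulr_swap4 (R : comNzRingType) (s x q h : R) : s * x * q * h = x * (s * (h * q)).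
Proof. by ring. Qed.

Lemma mulr_swap5 (R : comNzRingType) (s m x q y : R) : s * m * x * q * y = m * (s * (x * y) * q).
Proof. by ring. Qed.

Lemma mulr_swap7 (R : comNzRingType) (cA cB zA zB s a b : R) :
  cA * cB * (s * a * b) * (zA * zB) = s * (cA * a * zA * (cB * b * zB)).
Proof. by ring. Qed.

(** * Sums over set partitions *)

Section Packing.
Variables (T C : finType) (verts : C -> {set T}).
Implicit Types (U : {set T}) (S : {set C}) (c d : C) (x : T).

(** The map [verts] is left arbitrary so that the same recursion serves subgraph triples
    ([verts := ct_verts]) and plain set partitions ([verts := id]). *)
Definition packing U S :=
  [&& [forall c in S, verts c != set0],
      [forall c in S, [forall d in S, (c != d) ==> [disjoint verts c & verts d]]]
    & (\bigcup_(c in S) verts c)%SET == U].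

Lemma packingP U S :
  reflect [/\ forall c, c \in S -> exists x, x \in verts c,
              forall c d x, c \in S -> d \in S ->
                x \in verts c -> x \in verts d -> c = d
            & forall x, x \in U <-> exists2 c, c \in S & x \in verts c]
          (packing U S).
Proof.
apply: (iffP and3P) => [[/forall_inP n0 /forall_inP dis /eqP <-]|[n0 dis cov]]; split.
- by move=> c /n0 /set0Pn.
- move=> c d x cS dS xc xd; apply/eqP; apply: contraT => cd.
  have /forall_inP/(_ d dS) := dis _ cS.
  by rewrite cd /= => /pred0P/(_ x) /=; rewrite xc xd.
- by move=> x; split=> /bigcupP.
- by apply/forall_inP => c /n0 /set0Pn.
- apply/forall_inP => c cS; apply/forall_inP => d dS; apply/implyP => cd.
  apply/pred0P => x /=; apply/negbTE/negP => /andP[xc xd].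
  by rewrite (dis _ _ _ cS dS xc xd) eqxx in cd.
- by apply/eqP/setP => x; apply/bigcupP/idP => /cov.
Qed.

Variables (R : comNzRingType) (w : C -> R).

Definition packing_sum U : R := \sum_(S | packing U S) \prod_(c in S) w c.

Lemma packing_sum0 : packing_sum set0 = 1.
Proof.
rewrite /packing_sum (big_pred1 set0) ?big_set0 // => S /=.
apply/packingP/eqP => [[n0 _ cov]|->].
  apply/setP => c; rewrite inE; apply/negP => cS.
  have [x xc] := n0 _ cS.
  by have := (cov x).2 (ex_intro2 _ _ c cS xc); rewrite inE.
split=> [c|c d x|x]; rewrite ?inE //.
by split=> [|[c]] //; rewrite inE.
Qed.

(** The point [x] makes [verts c] nonempty, so [c] cannot belong to a packing of the complement. The
    factor [c \notin S] makes adding [c] to [S] injective. *)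
Lemma packing_cons U c S x : x \in verts c -> verts c \subset U ->
  packing (U :\: verts c) S = packing U (c |: S) && (c \notin S).
Proof.
move=> xc cU; apply/packingP/andP => [[n0 dis cov]|[/packingP[n0 dis cov] cS]].
  have nc d y : d \in S -> y \in verts d -> y \notin verts c.
    move=> dS yd; have := (cov y).2 (ex_intro2 _ _ d dS yd).
    by rewrite inE => /andP[].
  have cS : c \notin S.
    by apply/negP => cS; have := nc _ _ cS xc; rewrite xc.
  split=> //; apply/packingP; split.
  - by move=> d; rewrite !inE => /orP[/eqP->|/n0 //]; exists x.
  - move=> d d' y; rewrite !inE => /orP[/eqP->|dS] /orP[/eqP->|dS'] //.
    + by move=> yc yd; have := nc _ _ dS' yd; rewrite yc.
    + by move=> yc yd; have := nc _ _ dS yc; rewrite yd.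
    + exact: dis.
  - move=> y; split=> [yU|[d]].
      have [yc|yc] := boolP (y \in verts c); first by exists c; rewrite // setU11.
      have /cov[d dS yd] : y \in U :\: verts c by rewrite inE yc.
      by exists d; rewrite // inE dS orbT.
    rewrite !inE => /orP[/eqP-> /(subsetP cU) //|dS yd].
    by have := (cov y).2 (ex_intro2 _ _ d dS yd); rewrite inE => /andP[].
split.
- by move=> d dS; apply: n0; rewrite inE dS orbT.
- by move=> d d' y dS dS'; apply: dis; rewrite inE ?dS ?dS' orbT.
- move=> y; rewrite inE; split=> [/andP[yc /cov[d]]|[d dS yd]].
    by rewrite !inE => /orP[/eqP->|dS yd]; [rewrite (negbTE yc)|exists d].
  have dcS : d \in c |: S by rewrite inE dS orbT.
  apply/andP; split; last by apply/cov; exists d.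
  apply/negP => yc; move: cS.
  by rewrite (dis _ _ _ (setU11 _ _) dcS yc yd) dS.
Qed.

(** Exactly one member of a packing contains [x]; the others pack the complement of its vertex set.
    The later identities for packings and partitions follow from this recursion by induction on the
    size of [U]. *)
Lemma packing_sum_rec U x : x \in U ->
  packing_sum U =
  \sum_(c | (x \in verts c) && (verts c \subset U))
    w c * packing_sum (U :\: verts c).
Proof.
move=> xU; transitivity (\sum_(c | (x \in verts c) && (verts c \subset U))
    \sum_(S | packing U S && (c \in S)) \prod_(d in S) w d).
  rewrite [RHS](exchange_big_dep (packing U)) /=; last by move=> c S _ /andP[].
  apply: eq_bigr => S US; have /packingP[n0 dis cov] := US.
  have [c cS xc] := (cov x).1 xU.
  rewrite [RHS](big_pred1 c) // => d /=; rewrite US /=.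
  apply/andP/eqP => [[/andP[xd _] dS]|->]; first exact: dis dS cS xd xc.
  rewrite xc cS; split=> //=; apply/subsetP => y yc.
  by apply/cov; exists c.
apply: eq_bigr => c /andP[xc cU]; rewrite big_distrr /=.
rewrite (reindex_onto (fun S => c |: S) (fun S => S :\ c)) /=; last first.
  by move=> S /andP[_ cS]; rewrite setD1K.
apply: eq_big => [S|S].
  rewrite (packing_cons _ xc cU) setU11 andbT; congr (_ && _).
  apply/eqP/idP => [<-|cS]; first by rewrite !inE eqxx.
  by rewrite setU1K.
move=> /andP[/andP[_ _] /eqP e].
by rewrite big_setU1 // -e !inE eqxx.
Qed.

End Packing.

Section Blocks.
Variables (T : finType) (R : comNzRingType).
Implicit Types (U V : {set T}) (W : {set T} -> R).

Definition partition_sum W U : R := packing_sum (@id {set T}) W U.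

Lemma card_setD_lt (U B : {set T}) x : x \in U -> x \in B -> (#|U :\: B| < #|U|)%N.
Proof.
move=> xU xB; apply: proper_card; apply/properP; split; first exact: subsetDl.
by exists x; rewrite // !inE xB.
Qed.

(** Both sides obey the same recursion once the objects containing a given point are grouped by
    vertex set. This sums out everything in a component triple except its vertices. *)
Lemma packing_sum_blocks (C : finType) (verts : C -> {set T}) (w : C -> R) U :
  packing_sum verts w U = partition_sum (fun B => \sum_(c | verts c == B) w c) U.
Proof.
have [m] := ubnP #|U|; elim: m U => // m IH U lt_m.
have [->|[x xU]] := set_0Vmem U; first by rewrite /partition_sum !packing_sum0.
rewrite /partition_sum !(packing_sum_rec _ _ xU).
rewrite (partition_big verts (fun B => (x \in B) && (B \subset U))) //=.
apply: eq_bigr => B /andP[xB BU]; rewrite big_distrl /=.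
apply: eq_big => [c|c /andP[_ /eqP ->]].
  by case: eqP => [->|]; rewrite ?andbF // xB BU.
by rewrite IH // (leq_trans (card_setD_lt xU xB)).
Qed.

Lemma partition_sum_rec W U x : x \in U ->
  partition_sum W U =
  \sum_(B : {set T} | (x \in B) && (B \subset U)) W B * partition_sum W (U :\: B).
Proof. exact: packing_sum_rec. Qed.

Lemma partition_sum_disjoint W U V : [disjoint U & V] ->
  (forall (B : {set T}) u v, B \subset U :|: V ->
     u \in U -> v \in V -> u \in B -> v \in B -> W B = 0) ->
  partition_sum W (U :|: V) = partition_sum W U * partition_sum W V.
Proof.
have [m] := ubnP #|U|; elim: m U => // m IH U lt_m UV W0.
have [->|[x xU]] := set_0Vmem U.
  by rewrite set0U [partition_sum W set0]packing_sum0 mul1r.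
have xUV : x \in U :|: V by rewrite inE xU.
rewrite (partition_sum_rec _ xUV) (partition_sum_rec _ xU) big_distrl /=.
(* A block through [x] that is not inside [U] also meets [V], so it has weight 0. *)
rewrite (bigID (fun B : {set T} => B \subset U)) /= [X in _ + X]big1 ?addr0; last first.
  move=> B /andP[/andP[xB BUV] /subsetPn[y yB yU]].
  have := subsetP BUV _ yB; rewrite inE (negbTE yU) /= => yV.
  by rewrite (W0 B x y) // mul0r.
apply: eq_big => [B|B /andP[/andP[xB _] BU]].
  rewrite -andbA; congr (_ && _); apply/andP/idP => [[] //|BU]; split=> //.
  exact: subset_trans BU (subsetUl _ _).
rewrite setDUl (setDidPl (_ : [disjoint V & B])); last first.
  by rewrite disjoint_sym; exact: disjointWl BU UV.
rewrite IH ?mulrA //.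
- exact: leq_trans (card_setD_lt xU xB) lt_m.
- exact: disjointWl (subsetDl _ _) UV.
- by move=> B' u v /subset_trans B'UV; rewrite inE => /andP[_ uU];
  apply: W0 => //; apply: B'UV; exact: setSU (subsetDl _ _).
Qed.

End Blocks.

Lemma subset_imset_inj (T T' : finType) (f : T -> T') (A B : {set T}) :
  injective f -> (f @: A \subset f @: B) = (A \subset B).
Proof.
move=> f_inj; apply/subsetP/subsetP => sub y.
  by move=> yA; have := sub (f y) (imset_f f yA); rewrite mem_imset.
by move=> /imsetP[z zA ->]; apply: imset_f; exact: sub.
Qed.

(** Weights need to agree only on subsets of [U]; with [f] the identity this also serves to change
    the weight. *)
Lemma partition_sum_imset (R : comNzRingType) (T T' : finType) (f : T -> T')
    (W : {set T} -> R) (W' : {set T'} -> R) (U : {set T}) :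
  injective f -> (forall B : {set T}, B \subset U -> W' (f @: B) = W B) ->
  partition_sum W' (f @: U) = partition_sum W U.
Proof.
move=> f_inj; have [m] := ubnP #|U|; elim: m U => // m IH U lt_m WW.
have [->|[x xU]] := set_0Vmem U; first by rewrite imset0 /partition_sum !packing_sum0.
rewrite (partition_sum_rec _ (imset_f f xU)) (partition_sum_rec _ xU).
rewrite (reindex_onto (fun B : {set T} => f @: B) (fun B : {set T'} => f @^-1: B)) /=; last first.
  move=> B /andP[_ /subsetP BU]; apply/setP => y; apply/imsetP/idP => [[z]|yB].
    by rewrite inE => ? ->.
  by have /imsetP[z zU yz] := BU y yB; exists z; rewrite // inE -yz.
apply: eq_big => [B|B /andP[/andP[xB BU] _]].
  rewrite (mem_imset _ _ f_inj) (_ : f @^-1: (f @: B) == B) ?andbT; last first.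
    by apply/eqP/setP => y; rewrite inE mem_imset.
  by rewrite subset_imset_inj.
rewrite mem_imset // in xB; rewrite subset_imset_inj // in BU.
rewrite WW // (_ : f @: U :\: f @: B = f @: (U :\: B)); last first.
  apply/setP => y; rewrite inE; apply/andP/imsetP => [[yB /imsetP[z zU yz]]|[z]].
    by exists z; rewrite // inE zU andbT; move: yB; rewrite yz mem_imset.
  by rewrite inE => /andP[zB zU] ->; rewrite !mem_imset.
congr (_ * _); apply: IH => [|B' sB'].
  exact: leq_trans (card_setD_lt xU xB) lt_m.
by apply: WW; apply: subset_trans sB' (subsetDl _ _).
Qed.

Lemma eq_partition_sum (T : finType) (R : comNzRingType) (W W' : {set T} -> R) (U : {set T}) :
  (forall B : {set T}, B \subset U -> W' B = W B) -> partition_sum W' U = partition_sum W U.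
Proof.
move=> WW; rewrite -[in LHS](imset_id U); apply: partition_sum_imset => // B /WW.
by rewrite imset_id.
Qed.

(** * Connected subgraphs of a wedge *)

Lemma connect_ind (T : finType) (e : rel T) (P : T -> Prop) x y :
  (forall u v, P u -> e u v -> P v) -> P x -> connect e x y -> P y.
Proof.
move=> step Px /connectP[p pth ->]; elim: p x Px pth => //= z p IH x Px /andP[exz].
by apply: IH; exact: step exz.
Qed.

Section Connected.
Variable T : finType.
Implicit Types (A B : {set T}) (E EE : {set {set T}}).

Definition adj E : rel T := fun x y => [set x; y]%SET \in E.

Lemma adj_connect_sym E : connect_sym (adj E).
Proof. by apply: sym_connect_sym => x y; rewrite /adj setUC. Qed.

Definition connected_on E B :=
  [&& B != set0, [forall e in E, (e : {set T}) \subset B]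
    & [forall u in B, [forall v in B, connect (adj E) u v]]].

Lemma connected_onP E B :
  reflect [/\ exists x, x \in B, forall e, e \in E -> e \subset B
            & forall u v, u \in B -> v \in B -> connect (adj E) u v]
          (connected_on E B).
Proof.
apply: (iffP and3P) => [[/set0Pn n0 /forall_inP sub /forall_inP con]|[n0 sub con]]; split=> //.
- by move=> u v /con /forall_inP; apply.
- exact/set0Pn.
- exact/forall_inP.
- by apply/forall_inP => u uB; apply/forall_inP => v; exact: con.
Qed.

Lemma connected_on_root E B x : x \in B -> (forall e, e \in E -> e \subset B) ->
  (forall u, u \in B -> connect (adj E) u x) -> connected_on E B.
Proof.
move=> xB sub con; apply/connected_onP; split=> //; first by exists x.
move=> u v uB vB; apply: connect_trans (con _ uB) _.
by rewrite adj_connect_sym; exact: con.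
Qed.

(** The variable is $t$. When the graph induced on [B] is connected, this is $t^{|B|-1}$ times its
    Tutte polynomial at $(1,1+t)$. *)
Definition connected_poly (R : comNzRingType) EE B : {poly R} :=
  \sum_(E : {set {set T}} | (E \subset EE) && connected_on E B) 'X^#|E|.

End Connected.

(* Two sets glued at a point, through their embeddings [l], [r] and the
   retractions that collapse the other side to the gluing point. *)
Record wedge (T1 T2 T : finType) (x1 : T1) (x2 : T2) := Wedge {
  wl : T1 -> T;
  wr : T2 -> T;
  wpl : T -> T1;
  wpr : T -> T2;
  wlK : cancel wl wpl;
  wrK : cancel wr wpr;
  wlr : forall a, wpr (wl a) = x2;
  wrl : forall b, wpl (wr b) = x1;
  w_glue : wl x1 = wr x2;
  w_cover : forall z, (exists a, z = wl a) \/ (exists b, z = wr b) }.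

Section Wedge.
Variables (T1 T2 T : finType) (x1 : T1) (x2 : T2) (w : wedge T x1 x2).
Local Notation l := (wl w).
Local Notation r := (wr w).
Implicit Types (A : {set T1}) (B : {set T2}).

Definition im2 (S S' : finType) (f : S -> S') (EE : {set {set S}}) : {set {set S'}} :=
  [set f @: (e : {set S}) | e in EE].

Lemma wl_inj : injective l. Proof. exact: can_inj (wlK w). Qed.
Lemma wr_inj : injective r. Proof. exact: can_inj (wrK w). Qed.
#[local] Hint Resolve wl_inj wr_inj : core.

Lemma wedge_eq a b : l a = r b -> a = x1 /\ b = x2.
Proof. by move=> e; split; [rewrite -[a](wlK w) e wrl|rewrite -[b](wrK w) -e wlr]. Qed.

Definition wunion A B : {set T} := l @: A :|: r @: B.

(** The two images meet only in the glued point, so [B] could add to the left side only that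
    point. *)
Lemma mem_wunion_l A B a : (x2 \in B -> x1 \in A) -> (l a \in wunion A B) = (a \in A).
Proof.
move=> BA; rewrite inE mem_imset //; case: (boolP (a \in A)) => //= aA.
by apply/negbTE/negP => /imsetP[b bB] /wedge_eq[ax bx]; rewrite ax BA -?bx in aA.
Qed.

Lemma mem_wunion_r A B b : (x1 \in A -> x2 \in B) -> (r b \in wunion A B) = (b \in B).
Proof.
move=> AB; rewrite inE orbC mem_imset //; case: (boolP (b \in B)) => //= bB.
by apply/negbTE/negP => /imsetP[a aA] /esym /wedge_eq[ax bx]; rewrite bx AB -?ax in bB.
Qed.

Lemma wunion_preim (U : {set T}) : wunion (l @^-1: U) (r @^-1: U) = U.
Proof.
apply/setP => z; rewrite inE; apply/orP/idP => [[]/imsetP[y]|zU].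
- by rewrite inE => ? ->.
- by rewrite inE => ? ->.
by case: (w_cover w z) => -[y zy]; [left|right]; apply/imsetP; exists y; rewrite // inE -zy.
Qed.

Lemma wunion_pair_bij A B : x1 \in A -> x2 \in B ->
  (l @^-1: wunion A B = A) * (r @^-1: wunion A B = B).
Proof.
move=> xA xB; split; apply/setP => y; rewrite inE.
  by rewrite mem_wunion_l.
by rewrite mem_wunion_r.
Qed.

Lemma setC_wunion A B : x1 \in A -> x2 \in B -> ~: wunion A B = wunion (~: A) (~: B).
Proof.
move=> xA xB; apply/setP => z; rewrite inE; case: (w_cover w z) => -[y ->].
  by rewrite !mem_wunion_l ?inE ?xA ?xB.
by rewrite !mem_wunion_r ?inE ?xA ?xB.
Qed.

Lemma card_wunion A B : x1 \in A -> x2 \in B -> #|wunion A B| = (#|A| + #|B|).-1.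
Proof.
move=> xA xB; rewrite cardsU !card_imset // (_ : _ :&: _ = [set l x1]) ?cards1 ?subn1 //.
apply/setP => z; rewrite !inE; apply/andP/eqP => [[/imsetP[a aA ->] /imsetP[b bB]]|->].
  by move/wedge_eq=> [->].
by split; [exact: imset_f|rewrite (w_glue w); exact: imset_f].
Qed.

Lemma sum_wunion (V : nmodType) (F : {set T} -> V) :
  \sum_(U : {set T} | l x1 \in U) F U =
  \sum_(A : {set T1} | x1 \in A) \sum_(B : {set T2} | x2 \in B) F (wunion A B).
Proof.
rewrite pair_big /= (reindex_onto (fun AB => wunion AB.1 AB.2)
  (fun U => (l @^-1: U, r @^-1: U))) /=; last by move=> U _; exact: wunion_preim.
apply: eq_bigl => -[A B] /=; apply/andP/andP => [[xU /eqP [eA eB]]|[xA xB]].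
  by split; [rewrite -eA|rewrite -eB]; rewrite in_set -?(w_glue w).
by rewrite !wunion_pair_bij // inE imset_f.
Qed.

Section Edges.
Variables (E1 : {set {set T1}}) (E2 : {set {set T2}}).

(** The retraction sends a left edge to itself and collapses a right edge to [x1], so a walk in the
    wedge projects to a walk on the left. *)
Lemma adj_wedge_l u v : adj (im2 l E1 :|: im2 r E2) u v ->
  wpl w u = wpl w v \/ adj E1 (wpl w u) (wpl w v).
Proof.
rewrite /adj inE => /orP[] /imsetP[e eE uv].
  right; have : wpl w @: [set u; v] = wpl w @: (l @: e) by rewrite uv.
  by rewrite imsetU1 imset_set1 -imset_comp (eq_imset _ (wlK w)) imset_id => ->.
left; have im z : z \in [set u; v] -> wpl w z = x1.
  by rewrite uv => /imsetP[b _ ->]; exact: wrl.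
by rewrite !im ?set21 ?set22.
Qed.

Lemma connect_wedge_l u v : connect (adj (im2 l E1 :|: im2 r E2)) u v ->
  connect (adj E1) (wpl w u) (wpl w v).
Proof.
apply: (connect_ind (P := fun z => connect _ _ (wpl w z))) => // y z.
by move=> uy /adj_wedge_l[<- //|yz]; exact: connect_trans uy (connect1 yz).
Qed.

Lemma connect_wunion_l a b : connect (adj E1) a b ->
  connect (adj (im2 l E1 :|: im2 r E2)) (l a) (l b).
Proof.
apply: (connect_ind (P := fun z => connect _ _ (l z))) => // y z.
move=> ay yz; apply: connect_trans ay (connect1 _).
rewrite /adj inE (_ : [set l y; l z] = l @: [set y; z]).
  by apply/orP; left; apply: imset_f; exact: yz.
by rewrite imsetU1 imset_set1.
Qed.

End Edges.

End Wedge.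

(** Transfers the left-hand lemmas to the right. It is transparent, so that the embeddings of the
    swapped wedge reduce to those of [w]. *)
Definition wedge_swap (T1 T2 T : finType) (x1 : T1) (x2 : T2) (w : wedge T x1 x2) :
  wedge T x2 x1.
Proof.
apply: (@Wedge T2 T1 T x2 x1 (wr w) (wl w) (wpr w) (wpl w)).
- exact: wrK.
- exact: wlK.
- exact: wrl.
- exact: wlr.
- exact/esym/w_glue.
- by move=> z; case: (w_cover w z); [right|left].
Defined.

Section WedgeConnected.
Variables (T1 T2 T : finType) (x1 : T1) (x2 : T2) (w : wedge T x1 x2).
Local Notation l := (wl w).
Local Notation r := (wr w).
Implicit Types (A : {set T1}) (B : {set T2}).

Lemma connect_wedge_r E1 E2 u v : connect (adj (im2 l E1 :|: im2 r E2)) u v ->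
  connect (adj E2) (wpr w u) (wpr w v).
Proof. by rewrite setUC; exact: (connect_wedge_l (w := wedge_swap w)). Qed.

Lemma connect_wunion_r E1 E2 a b : connect (adj E2) a b ->
  connect (adj (im2 l E1 :|: im2 r E2)) (r a) (r b).
Proof. by rewrite setUC; exact: (connect_wunion_l (wedge_swap w)). Qed.

Lemma im2_sub (S S' : finType) (f : S -> S') (E : {set {set S}}) (U : {set S'}) :
  (forall e, e \in im2 f E -> e \subset U) <-> (forall e, e \in E -> e \subset f @^-1: U).
Proof.
split=> sub e.
  by move=> eE; rewrite -sub_imset_pre; apply/sub/imset_f.
by move=> /imsetP[d dE ->]; rewrite sub_imset_pre sub.
Qed.

Lemma wedge_edges_sub E1 E2 (U : {set T}) :
  (forall e, e \in im2 l E1 :|: im2 r E2 -> e \subset U) <->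
  (forall e, e \in E1 -> e \subset l @^-1: U) /\ (forall e, e \in E2 -> e \subset r @^-1: U).
Proof.
rewrite -!im2_sub; split=> [sub|[sub1 sub2] e]; last by rewrite inE => /orP[/sub1|/sub2].
by split=> e eE; apply: sub; rewrite inE eE ?orbT.
Qed.

(** Connectivity projects to each side by the retractions. Conversely, each side connects all its
    vertices to the glued point. *)
Lemma connected_wunion E1 E2 A B : x1 \in A -> x2 \in B ->
  connected_on (im2 l E1 :|: im2 r E2) (wunion w A B) =
  connected_on E1 A && connected_on E2 B.
Proof.
move=> xA xB; have [eA eB] := wunion_pair_bij w xA xB.
apply/idP/andP => [/connected_onP[_ /wedge_edges_sub + con]|].
  rewrite eA eB => -[sub1 sub2]; split.
    apply: (connected_on_root xA) => // u uA; rewrite -[u](wlK w) -[x1 in connect _ _ x1](wlK w).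
    by apply: (connect_wedge_l (E2 := E2)); apply: con; rewrite inE imset_f.
  apply: (connected_on_root xB) => // u uB; rewrite -[u](wrK w) -[x2 in connect _ _ x2](wrK w).
  by apply: (connect_wedge_r (E1 := E1)); apply: con; rewrite inE imset_f ?orbT.
move=> [/connected_onP[_ sub1 con1] /connected_onP[_ sub2 con2]].
apply: (@connected_on_root _ _ _ (l x1)); first by rewrite inE imset_f.
  by apply/wedge_edges_sub; rewrite eA eB.
move=> z; rewrite inE => /orP[] /imsetP[y yS ->].
  exact/connect_wunion_l/con1.
by rewrite (w_glue w); exact/connect_wunion_r/con2.
Qed.

Lemma connected_wl (E1 : {set {set T1}}) (E2 : {set {set T2}}) A :
  [forall e in E2, #|e : {set T2}| == 2%N] ->
  connected_on (im2 l E1 :|: im2 r E2) (l @: A) = (E2 == set0) && connected_on E1 A.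
Proof.
move=> card2; have lA : l @^-1: (l @: A) = A.
  by apply/setP => a; rewrite inE mem_imset //; exact: wl_inj.
apply/idP/andP => [/connected_onP[[_ /imsetP[a aA _]] /wedge_edges_sub[sub1 sub2] con]|[/eqP-> ]].
  split.
    apply/set0Pn => -[e eE]; have := forall_inP card2 e eE.
    (* Seen from the right, the image of [A] contains at most the glued point, which cannot hold an
       edge with two ends. *)
    suff : (#|e| <= #|[set x2]|)%N by rewrite cards1; case: #|e| => [|[]].
    apply/subset_leq_card/subsetP => b /(subsetP (sub2 e eE)); rewrite !inE.
    by case/imsetP => c _ /esym /wedge_eq[_ ->].
  rewrite lA in sub1; apply/connected_onP; split=> // [|u v uA vA]; first by exists a.
  rewrite -[u](wlK w) -[v](wlK w); apply: (connect_wedge_l (E2 := E2)).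
  by apply: con; exact: imset_f.
move=> /connected_onP[[a aA] sub con]; apply/connected_onP; split.
- by exists (l a); exact: imset_f.
- by apply/wedge_edges_sub; rewrite lA; split=> // e; rewrite inE.
- move=> _ _ /imsetP[u uA ->] /imsetP[v vA ->].
  exact/connect_wunion_l/con.
Qed.

(* Away from the gluing point, no edge leaves the left side. *)
Lemma connected_wedge_sep E1 E2 (U : {set T}) a b :
  l x1 \notin U -> l a \in U -> r b \in U ->
  connected_on (im2 l E1 :|: im2 r E2) U = false.
Proof.
move=> xU aU bU; apply/negP => /connected_onP[_ sub con].
suff [c e _] : exists2 c, r b = l c & c != x1.
  by have [_ bx] := wedge_eq (esym e); rewrite bx -(w_glue w) (negbTE xU) in bU.
have neq c : l c \in U -> c != x1 by move=> cU; apply/eqP => cx; rewrite -(congr1 l cx) cU in xU.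
move: (con _ _ aU bU).
apply: (connect_ind (P := fun z => exists2 c, z = l c & c != x1));
  last by exists a => //; exact: neq.
move=> u v [c -> cx] cv; have vU : v \in U by apply: (subsetP (sub _ cv)); exact: set22.
move: cv; rewrite /adj inE => /orP[] /imsetP[e _ ev].
  have : v \in [set l c; v] by exact: set22.
  by rewrite ev => /imsetP[d _ vd]; exists d => //; apply: neq; rewrite -vd.
have : l c \in [set l c; v] by exact: set21.
by rewrite ev => /imsetP[d _ /wedge_eq[ce _]]; rewrite ce eqxx in cx.
Qed.

Variables (EE1 : {set {set T1}}) (EE2 : {set {set T2}}).
Hypothesis card2 : [forall e in EE1, #|e : {set T1}| == 2%N].
Hypothesis card2' : [forall e in EE2, #|e : {set T2}| == 2%N].

Lemma wedge_edge_neq (e1 : {set T1}) (e2 : {set T2}) : e1 \in EE1 -> l @: e1 <> r @: e2.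
Proof.
move=> eE ll; have := forall_inP card2 e1 eE.
suff : (#|e1| <= #|[set x1]|)%N by rewrite cards1; case: #|e1| => [|[]].
apply/subset_leq_card/subsetP => a ae.
have := imset_f l ae; rewrite ll => /imsetP[b _ /wedge_eq[-> _]].
exact: set11.
Qed.

Lemma sum_wedge_edges (V : nmodType) (F : {set {set T}} -> V) :
  \sum_(E : {set {set T}} | E \subset im2 l EE1 :|: im2 r EE2) F E =
  \sum_(E1 : {set {set T1}} | E1 \subset EE1) \sum_(E2 : {set {set T2}} | E2 \subset EE2)
    F (im2 l E1 :|: im2 r E2).
Proof.
pose pl (E : {set {set T}}) := [set e in EE1 | l @: (e : {set T1}) \in E].
pose pr (E : {set {set T}}) := [set e in EE2 | r @: (e : {set T2}) \in E].
rewrite pair_big /= (reindex_onto (fun E => im2 l E.1 :|: im2 r E.2)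
   (fun E => (pl E, pr E))) /=; last first.
  move=> E sub; apply/setP => e; rewrite inE; apply/orP/idP => [[]|eE].
  - by move=> /imsetP[d]; rewrite inE => /andP[_ ?] ->.
  - by move=> /imsetP[d]; rewrite inE => /andP[_ ?] ->.
  have := subsetP sub e eE; rewrite inE => /orP[] /imsetP[d dE ed]; [left|right];
    by apply/imsetP; exists d => //; rewrite inE dE -ed.
apply: eq_bigl => -[E1 E2] /=; apply/andP/andP => [[_ /eqP [<- <-]]|[sub1 sub2]].
  by split; apply/subsetP => e; rewrite inE => /andP[].
split; first by apply: setUSS; exact: imsetS.
have lr := @wedge_edge_neq.
apply/eqP; congr (_, _); apply/setP => e; rewrite !inE.
  apply/andP/idP => [[eE]|eE]; last by rewrite imset_f // (subsetP sub1).
  rewrite mem_imset; last exact/imset_inj/wl_inj.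
  by case/orP=> // /imsetP[d _ /(lr _ _ eE)].
apply/andP/idP => [[eE]|eE]; last by rewrite imset_f ?orbT // (subsetP sub2).
rewrite orbC mem_imset; last exact/imset_inj/wr_inj.
by case/orP=> // /imsetP[d dE /esym /(lr _ _ (subsetP sub1 _ dE))].
Qed.

Lemma wedge_edges_split (E : {set {set T}}) : E \subset im2 l EE1 :|: im2 r EE2 ->
  exists (E1 : {set {set T1}}) (E2 : {set {set T2}}),
    [/\ E1 \subset EE1, E2 \subset EE2 & E = im2 l E1 :|: im2 r E2].
Proof.
move=> sub; exists [set e in EE1 | l @: (e : {set T1}) \in E].
exists [set e in EE2 | r @: (e : {set T2}) \in E]; split.
- by apply/subsetP => e; rewrite inE => /andP[].
- by apply/subsetP => e; rewrite inE => /andP[].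
apply/setP => e; rewrite inE; apply/idP/orP => [eE|].
  have := subsetP sub e eE; rewrite inE => /orP[] /imsetP[d dE ed]; [left|right];
    by apply/imsetP; exists d => //; rewrite inE dE -ed.
by case=> /imsetP[d]; rewrite inE => /andP[_ ?] ->.
Qed.

Lemma card_wedge_edges (E1 : {set {set T1}}) (E2 : {set {set T2}}) : E1 \subset EE1 ->
  #|im2 l E1 :|: im2 r E2| = (#|E1| + #|E2|)%N.
Proof.
move=> sub; rewrite cardsU (_ : _ :&: _ = set0) ?cards0 ?subn0.
  by rewrite !card_imset //; apply: imset_inj; [exact: wr_inj|exact: wl_inj].
apply/eqP; rewrite -subset0; apply/subsetP => e; rewrite inE => /andP[].
by move=> /imsetP[d /(subsetP sub) dE ->] /imsetP[d' _ /(wedge_edge_neq dE)].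
Qed.

Variable R : comNzRingType.

Lemma connected_poly_wunion A B : x1 \in A -> x2 \in B ->
  connected_poly R (im2 l EE1 :|: im2 r EE2) (wunion w A B) =
  connected_poly R EE1 A * connected_poly R EE2 B.
Proof.
move=> xA xB; rewrite /connected_poly big_mkcondr sum_wedge_edges /=.
rewrite big_distrl [RHS]big_mkcondr; apply: eq_bigr => E1 sub1 /=.
have [con1|con1] := boolP (connected_on E1 A); last first.
  by rewrite big1 // => E2 _; rewrite connected_wunion // (negbTE con1).
rewrite big_distrr [RHS]big_mkcondr; apply: eq_bigr => E2 sub2 /=.
by rewrite connected_wunion // con1 /=; case: ifP => // _; rewrite card_wedge_edges // exprD.
Qed.

(** Only the empty set of right edges contributes, since no right edge fits inside the left
    image. *)
Lemma connected_poly_wl A :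
  connected_poly R (im2 l EE1 :|: im2 r EE2) (l @: A) = connected_poly R EE1 A.
Proof.
rewrite /connected_poly big_mkcondr sum_wedge_edges /= [RHS]big_mkcondr.
apply: eq_bigr => E1 sub1 /=; rewrite (bigD1 set0) ?sub0set //=.
rewrite big1 => [|E2 /andP[sub2 /negbTE n0]].
  rewrite connected_wl ?eqxx //=; last by apply/forall_inP => e; rewrite inE.
  by rewrite card_wedge_edges // cards0 addn0 addr0.
rewrite connected_wl ?n0 //.
by apply/forall_inP => e eE; apply: (forall_inP card2'); exact: subsetP eE.
Qed.

Lemma connected_poly_sep (U : {set T}) a b :
  l x1 \notin U -> l a \in U -> r b \in U ->
  connected_poly R (im2 l EE1 :|: im2 r EE2) U = 0.
Proof.
move=> xU aU bU; rewrite /connected_poly big_mkcondr sum_wedge_edges /= big1 // => E1 _.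
by rewrite big1 // => E2 _; rewrite (connected_wedge_sep _ _ xU aU bU).
Qed.

End WedgeConnected.

Lemma connected_poly_wr (T1 T2 T : finType) (x1 : T1) (x2 : T2) (w : wedge T x1 x2)
    (EE1 : {set {set T1}}) (EE2 : {set {set T2}}) (R : comNzRingType) (B : {set T2}) :
  [forall e in EE1, #|e : {set T1}| == 2%N] -> [forall e in EE2, #|e : {set T2}| == 2%N] ->
  connected_poly R (im2 (wl w) EE1 :|: im2 (wr w) EE2) (wr w @: B) = connected_poly R EE2 B.
Proof.
by move=> c1 c2; rewrite setUC; exact: (connected_poly_wl (wedge_swap w) c2 c1).
Qed.

(** * Compositions *)

Lemma size_comp_leq n a : is_comp_of n a -> (size a <= n)%N.
Proof.
case/andP => + /eqP <-; elim: a => //= x a IH /andP[x1 /IH]; lia.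
Qed.

Lemma part_comp_leq n a x : is_comp_of n a -> x \in a -> (x <= n)%N.
Proof.
case/andP => _ /eqP <-; elim: a => //= y a IH; rewrite inE => /orP[/eqP->|/IH]; lia.
Qed.

(** Mirrors the finite type of [ct_parts], whose bound [n] comes from the whole graph while the size
    [m] comes from a block. *)
Definition bounded_comps (n m : nat) : seq (seq nat) :=
  [seq map val (b : {bseq n of 'I_n.+1}) |
    b in [pred b : {bseq n of 'I_n.+1} | is_comp_of m (map val b)]].

Definition comps (m : nat) : seq (seq nat) := bounded_comps m m.

Lemma mem_bounded_comps n m a : (m <= n)%N -> (a \in bounded_comps n m) = is_comp_of m a.
Proof.
move=> mn; apply/imageP/idP => [[b + ->] //|am].
have sza : (size (map (@inord n) a) <= n)%N.
  by rewrite size_map (leq_trans (size_comp_leq am)).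
have val_a : map val (map (@inord n) a) = a.
  rewrite -map_comp map_id_in // => x xa /=; rewrite inordK // ltnS.
  exact: leq_trans (part_comp_leq am xa) mn.
by exists (Bseq sza); rewrite ?inE /= val_a.
Qed.

Lemma uniq_bounded_comps n m : uniq (bounded_comps n m).
Proof.
rewrite map_inj_uniq ?enum_uniq // => b c /inj_map bc; apply: val_inj; apply: bc.
exact: val_inj.
Qed.

Lemma mem_comps m a : (a \in comps m) = is_comp_of m a.
Proof. exact: mem_bounded_comps. Qed.

Lemma sum_bounded_comps (V : nmodType) n m (F : seq nat -> V) : (m <= n)%N ->
  \sum_(b : {bseq n of 'I_n.+1} | is_comp_of m (map val b)) F (map val b) =
  \sum_(a <- comps m) F a.
Proof.
move=> mn; rewrite (perm_big (bounded_comps n m)) /=.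
  by rewrite big_image /=; apply: eq_bigl => b; rewrite inE.
apply: uniq_perm; rewrite ?uniq_bounded_comps // => a.
by rewrite mem_comps mem_bounded_comps.
Qed.

(* The shortest prefix of [s] with sum at least [n], and the remaining parts. *)
Fixpoint split_parts (n : nat) (s : seq nat) : seq nat * seq nat :=
  if s is x :: s' then
    if (n <= x)%N then ([:: x], s')
    else let uv := split_parts (n - x) s' in (x :: uv.1, uv.2)
  else ([::], [::]).

(** The strict inequality says that [u] without its last part has sum below [n], hence that [u] is
    the shortest prefix reaching [n]. *)
Lemma split_parts_cat n u v : u != [::] -> (sumn u < n + last 0 u)%N -> (n <= sumn u)%N ->
  split_parts n (u ++ v) = (u, v).
Proof.
elim: u n => //= x u IH n _; case: u IH => [|y u] IH lt_n le_n.
  by rewrite /= addn0 in le_n; rewrite le_n.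
have last_le (z : nat) s : (last z s <= z + sumn s)%N.
  by elim: s z => /= [|t s IHs] z; [lia|have := IHs t; lia].
have xn : (x < n)%N by have := last_le y u; move: lt_n => /=; lia.
have {}IH := IH (n - x)%N isT; rewrite /= in lt_n le_n IH.
by rewrite leqNgt xn /= IH //; lia.
Qed.

Lemma split_partsP n s : (0 < n)%N -> (n <= sumn s)%N ->
  let u := (split_parts n s).1 in let v := (split_parts n s).2 in
  [/\ s = u ++ v, u != [::], (sumn u < n + last 0 u)%N & (n <= sumn u)%N].
Proof.
elim: s n => [|x s IH] n n0 /=; first by rewrite leqNgt n0.
case: (leqP n x) => xn le_n; first by split=> //=; lia.
have [] := IH (n - x)%N; [lia|lia|move=> /= es u0 h1 h2].
split=> //=; first by rewrite -es.
  by case: (split_parts _ _).1 u0 h1 => //= y u _; lia.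
lia.
Qed.

Section CompositionSums.
Variables (R : comNzRingType) (e : nat -> R).
Implicit Types (f l : bool) (i j k m : nat).

(* The flags [f] and [l] tell whether the block contains vertex 1 and the last
   vertex of the graph; without [f], the first part counts the roots r. *)
Definition comp_weight f i (a : seq nat) : R :=
  if f then (head 0%N a == i)%:R * \prod_(k <- behead a) e k
  else (head 0%N a)%:R * \prod_(k <- a) e k.

(** The exponent [m + size a] has the parity of $m-\ell(\alpha)$. Here [j] counts from 0, so
    [j < last 0 a] asks for a last part at least $j+1$. *)
Definition comp_sum f l i j m : R :=
  \sum_(a <- comps m | l ==> (j < last 0 a)%N) (-1) ^+ (m + size a) * comp_weight f i a.

Definition glue_pairs (m n : nat) : seq (seq nat) :=
  [seq a ++ behead b | b <- comps n,
     a <- [seq a <- comps (m + (head 0%N b).-1) | ((head 0%N b).-1 < last 0 a)%N]].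

Lemma comps_cons n b : (0 < n)%N -> b \in comps n ->
  exists k b', [/\ b = k.+1 :: b', is_comp_of (n - k.+1) b' & (k.+1 + sumn b' = n)%N].
Proof.
rewrite mem_comps => n0 /andP[]; case: b => [|[|k] b] /=;
  [by move=> _ /eqP n1; rewrite -n1 in n0|by []|].
move=> pos /eqP <-; exists k, b; split=> //; rewrite /is_comp_of pos /=; apply/eqP; lia.
Qed.

(** The inverse of gluing is [split_parts m]: it returns [a] and the tail of [b], and the excess
    [sumn a - m] is one less than the lost first part of [b]. *)
Lemma glue_pairsP m n : (0 < m)%N -> (0 < n)%N -> perm_eq (comps (m + n).-1) (glue_pairs m n).
Proof.
move=> m0 n0; have facts b a : b \in comps n ->
    a \in [seq a <- comps (m + (head 0%N b).-1) | ((head 0%N b).-1 < last 0 a)%N] ->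
    split_parts m (a ++ behead b) = (a, behead b) /\ head 0%N b = (sumn a - m).+1.
  move=> /(comps_cons n0)[k [b' [-> _ _]]] /=; rewrite mem_filter mem_comps.
  move=> /and3P[ka _ /eqP sa]; split; last by lia.
  apply: split_parts_cat; [by case: (a) ka|lia|lia].
apply: uniq_perm; first exact: uniq_bounded_comps.
- apply: allpairs_uniq_dep; first exact: uniq_bounded_comps.
    by move=> b _; apply: filter_uniq; exact: uniq_bounded_comps.
  move=> _ _ /allpairsPdep[b [a [bn am ->]]] /allpairsPdep[b2 [a2 [bn2 am2 ->]]] /= eab.
  have [s1 h1] := facts _ _ bn am; have [s2 h2] := facts _ _ bn2 am2.
  move: s1; rewrite eab s2 => -[ea eb]; subst a2.
  suff eb2 : b = b2 by subst b2.
  have [k [b' [eb' _ _]]] := comps_cons n0 bn; have [k2 [b2' [eb2' _ _]]] := comps_cons n0 bn2.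
  by move: eb h1 h2; rewrite eb' eb2' /= => -> -> ->.
- move=> c; rewrite mem_comps; apply/andP/allpairsPdep => [[pos /eqP sc]|[b [a [bn]]]].
    have [] := @split_partsP m c m0; first by lia.
    move: (split_parts m c) => [u v] /= ec u0 h1 h2; subst c.
    move: pos; rewrite all_cat => /andP[pu pv]; rewrite sumn_cat in sc.
    exists ((sumn u - m).+1 :: v), u; split=> //.
      rewrite mem_comps /is_comp_of /= pv; apply/eqP; lia.
    by rewrite mem_filter mem_comps /is_comp_of pu /=; apply/andP; split; [lia|apply/eqP; lia].
  have [k [b' [eb cb sb]]] := comps_cons n0 bn; subst b => /=.
  rewrite mem_filter mem_comps => /and3P[ka pa /eqP sa] ->.
  case/andP: cb => pb _; rewrite all_cat pa pb sumn_cat; split=> //; apply/eqP; lia.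
Qed.

(** The bijection of [glue_pairsP], sorted by the first part [k.+1] of [b]. Any [K] at least [n]
    bounds the values of [k]. *)
Lemma comp_sum_glue f l i j m n K : (0 < m)%N -> (0 < n)%N -> (n <= K)%N ->
  (l -> j < n)%N ->
  comp_sum f l i j (m + n).-1 =
  \sum_(k < K) (-1) ^+ k * comp_sum f true i k (m + k) * comp_sum true l k.+1 j n.
Proof.
move=> m0 n0 nK ljn; under [RHS]eq_bigr do rewrite {2}/comp_sum big_distrr /=.
rewrite exchange_big /= {1}/comp_sum (perm_big _ (glue_pairsP m0 n0)) /=.
rewrite big_mkcond big_allpairs_dep /= [RHS]big_mkcond /=.
rewrite [LHS]big_seq [RHS]big_seq; apply: eq_bigr => b bn.
have [k [b' [eb cb sb]]] := comps_cons n0 bn; subst b => /=.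
have kK : (k < K)%N by lia.
transitivity (\sum_(a <- comps (m + k) | (k < last 0 a)%N)
  if l ==> (j < last k.+1 b')%N
  then (-1) ^+ ((m + n).-1 + size (a ++ b')) * comp_weight f i (a ++ b') else 0).
  rewrite big_filter big_seq_cond [RHS]big_seq_cond; apply: eq_bigr => a.
  rewrite mem_comps => /andP[/andP[_ /eqP sa] ka].
  (* If [b'] is empty, the last part of the glued composition is that of [a], not [k.+1]. Then
     [k.+1 = n], and [j < n] together with [k < last 0 a] makes both conditions true. *)
  suff -> : l ==> (j < last 0 (a ++ b'))%N = (l ==> (j < last k.+1 b')%N) by [].
  case: l ljn => //= /(_ isT) jn; rewrite last_cat.
  by case: b' cb sb bn => //= _ sb _; apply/idP/idP; lia.
case: ifP => // _; last by rewrite big1.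
(* The indicator in [comp_weight true k'.+1] keeps only the index equal to the first part of [b]
   minus 1. *)
rewrite (bigD1 (Ordinal kK)) //= [X in _ = _ + X]big1 ?addr0; last first.
  move=> k' /eqP kk; rewrite eqSS (_ : (k == k' :> nat) = false) ?mul0r ?mulr0 //.
  by apply/eqP => ekk; apply: kk; apply/val_inj.
rewrite eqxx mul1r {1}/comp_sum big_distrr big_distrl /=.
rewrite big_seq_cond [RHS]big_seq_cond; apply: eq_bigr => a.
rewrite mem_comps => /andP[/andP[_ /eqP sa] ka].
have -> : comp_weight f i (a ++ b') = comp_weight f i a * \prod_(k <- b') e k.
  case: a ka sa => //= x a _ _; rewrite /comp_weight /=.
  by case: ifP => _; rewrite ?big_cons big_cat /= !mulrA.
have -> : (-1) ^+ ((m + n).-1 + size (a ++ b')) =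
    (-1) ^+ k * (-1) ^+ (m + k + size a) * (-1) ^+ (n + (size b').+1) :> R.
  rewrite -!exprD -[LHS]signr_odd -[RHS]signr_odd; congr (_ ^+ nat_of_bool _).
  rewrite size_cat [X in _ = odd X](_ : _ = (m + n).-1 + (size a + size b') + k.+1.*2)%N;
    last by lia.
  by rewrite [RHS]oddD odd_double addbF.
by ring.
Qed.

End CompositionSums.

(** * Paths and graph sums *)

Section Path.
Variable p : nat.
Implicit Types (E : {set {set 'I_p.+1}}).

Definition path_edge (i : 'I_p) : {set 'I_p.+1} := [set inord i; inord i.+1].

Lemma path_edgesE : path_edges p = [set path_edge i | i : 'I_p].
Proof.
apply/setP => e; apply/imsetP/imsetP => [[[x y]]|[i _ ->]].
  rewrite inE /= => /eqP yx ->; have xp : (x < p)%N by have := ltn_ord y; rewrite yx.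
  by exists (Ordinal xp) => //; congr [set _; _]; apply/val_inj; rewrite /= inordK //.
have ip := ltn_ord i; exists (inord i, inord i.+1) => //.
by rewrite inE /= !inordK //; lia.
Qed.

Lemma path_edge_inj : injective path_edge.
Proof.
move=> i j ij; have ip := ltn_ord i; have jp := ltn_ord j.
have mem (k : 'I_p) (v : 'I_p.+1) : v \in path_edge k -> v = k :> nat \/ v = k.+1 :> nat.
  have kp := ltn_ord k.
  by rewrite !inE => /orP[]/eqP->; rewrite inordK //; [left|lia|right].
apply/val_inj => /=.
have := mem j (inord i.+1); rewrite -ij set22 inordK // => /(_ isT).
have := mem i (inord j.+1); rewrite ij set22 inordK // => /(_ isT).
lia.
Qed.

Lemma card_path_edges : #|path_edges p| = p.
Proof. by rewrite path_edgesE card_imset ?card_ord //; exact: path_edge_inj. Qed.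

Lemma connected_path E : E \subset path_edges p ->
  connected_on E setT = (E == path_edges p).
Proof.
move=> sub; apply/idP/eqP => [/connected_onP[_ _ con]|->].
  apply/eqP; rewrite eqEsubset sub path_edgesE; apply/subsetP => _ /imsetP[i _ ->].
  have ip := ltn_ord i; apply: contraT => iE.
  (* If the edge from [i] to [i.+1] is missing, no edge of [E] leaves the set of vertices of value
     at most [i]. *)
  suff : ((inord i.+1 : 'I_p.+1) <= i)%N by rewrite inordK // ltnn.
  move: (con (inord i) (inord i.+1) (in_setT _) (in_setT _)).
  apply: (connect_ind (P := fun z : 'I_p.+1 => (z <= i)%N)); last by rewrite inordK; lia.
  move=> u v ui uv; rewrite leqNgt; apply/negP => iv.
  have := subsetP sub _ uv; rewrite path_edgesE => /imsetP[k _ ek].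
  have kp := ltn_ord k; case/negP: iE; suff -> : i = k by rewrite -ek.
  apply/val_inj => /=; move: (set21 u v) (set22 u v); rewrite ek !inE.
  by move=> /orP[]/eqP eu /orP[]/eqP ev; move: ui iv; rewrite eu ev !inordK; lia.
apply: (@connected_on_root _ _ _ ord0) => // u _.
rewrite adj_connect_sym; case: u; elim=> [|n IH] np.
  by rewrite (_ : Ordinal np = ord0) //; exact: val_inj.
have np' : (n < p.+1)%N by lia.
apply: connect_trans (IH np') (connect1 _).
rewrite /adj path_edgesE; apply/imsetP; exists (Ordinal (np : (n < p)%N)) => //.
by congr [set _; _]; apply/val_inj; rewrite /= inordK.
Qed.

Lemma connected_poly_path (R : comNzRingType) :
  connected_poly R (path_edges p) setT = 'X^p.
Proof.
rewrite /connected_poly (big_pred1 (path_edges p)) ?card_path_edges // => E /=.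
apply/andP/eqP => [[sub]|->]; first by rewrite connected_path // => /eqP.
by rewrite connected_path.
Qed.

End Path.

Section OrdinalWedge.
Variables (n p q : nat).
Hypothesis npq : n = (p + q)%N.

Definition ord_l (a : 'I_p.+1) : 'I_n.+1 := inord a.
Definition ord_r (b : 'I_q.+1) : 'I_n.+1 := inord (b + p).
Definition ord_pl (z : 'I_n.+1) : 'I_p.+1 := inord (minn z p).
Definition ord_pr (z : 'I_n.+1) : 'I_q.+1 := inord (z - p).

Lemma ord_lE a : ord_l a = a :> nat.
Proof. by rewrite inordK //; have := ltn_ord a; lia. Qed.

Lemma ord_rE b : ord_r b = (b + p)%N :> nat.
Proof. by rewrite inordK //; have := ltn_ord b; lia. Qed.

Lemma ord_plE z : ord_pl z = minn z p :> nat.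
Proof. by rewrite inordK //; lia. Qed.

Lemma ord_prE z : ord_pr z = (z - p)%N :> nat.
Proof. by rewrite inordK //; have := ltn_ord z; lia. Qed.

(** The equation [n = p + q] is a hypothesis so that the vertices of $(G+H)+P$ can also be split as
    those of $G$ and $H+P$ without a cast. The minimum and the truncated subtraction collapse the
    opposite side to the glued vertex. *)
Definition ord_wedge : wedge 'I_n.+1 (ord_max : 'I_p.+1) (ord0 : 'I_q.+1).
Proof.
apply: (@Wedge _ _ _ _ _ ord_l ord_r ord_pl ord_pr).
- by move=> a; apply: ord_inj; rewrite ord_plE ord_lE /=; have := ltn_ord a; lia.
- by move=> b; apply: ord_inj; rewrite ord_prE ord_rE; lia.
- by move=> a; apply: ord_inj; rewrite ord_prE ord_lE /=; have := ltn_ord a; lia.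
- by move=> b; apply: ord_inj; rewrite ord_plE ord_rE /=; lia.
- by apply: ord_inj; rewrite ord_rE.
- move=> z; have [zp|pz] := leqP z p.
    by left; exists (ord_pl z); apply: ord_inj; rewrite ord_lE ord_plE; lia.
  by right; exists (ord_pr z); apply: ord_inj; rewrite ord_rE ord_prE; lia.
Defined.

End OrdinalWedge.

Lemma sum_edges_wedge p q (G : graph p) (H : graph q) :
  edges (sum_graph G H) =
  im2 (wl (ord_wedge (erefl (p + q)%N))) (edges G) :|:
  im2 (wr (ord_wedge (erefl (p + q)%N))) (edges H).
Proof. by []. Qed.

Lemma sum_graph_assoc_edges p q r (G : graph p) (H : graph q) (P : graph r) :
  let w := ord_wedge (esym (addnA p q r)) in
  edges (sum_graph (sum_graph G H) P) =
  im2 (wl w) (edges G) :|: im2 (wr w) (edges (sum_graph H P)).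
Proof.
have im2_comp (S1 S2 S3 : finType) (f : S2 -> S3) (g : S1 -> S2) (h : S1 -> S3) E :
    (forall x, f (g x) = h x) -> im2 f (im2 g E) = im2 h E.
  move=> fg; rewrite /im2 -imset_comp; apply: eq_imset => e /=.
  by rewrite -imset_comp; apply: eq_imset.
move=> w; rewrite !sum_edges_wedge /im2 !imsetU setUA; congr (_ :|: _ :|: _).
- apply: im2_comp => x; apply: ord_inj; have xp := ltn_ord x.
  by rewrite /= /ord_l !inordK ?inordK; lia.
- transitivity (im2 (fun y : 'I_q.+1 => inord (y + p) : 'I_(p + q + r).+1) (edges H)).
    apply: im2_comp => x; apply: ord_inj; have xp := ltn_ord x.
    by rewrite /= /ord_l /ord_r !inordK ?inordK; lia.
  apply/esym/im2_comp => x; apply: ord_inj; have xp := ltn_ord x.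
  by rewrite /= /ord_l /ord_r !inordK ?inordK; lia.
- transitivity (im2 (fun y : 'I_r.+1 => inord (y + q + p) : 'I_(p + q + r).+1) (edges P)).
    apply: eq_imset => e; apply: eq_imset => x; apply: ord_inj; have xp := ltn_ord x.
    by rewrite /= /ord_l /ord_r !inordK ?inordK; lia.
  apply/esym/im2_comp => x; apply: ord_inj; have xp := ltn_ord x.
  by rewrite /= /ord_l /ord_r !inordK ?inordK; lia.
Qed.

(** * Entries of the Tutte matrix as sums over set partitions *)

(** Source of the factor [head 0 a] in [comp_weight] for blocks without vertex 1. *)
Lemma card_roots n h : (h <= n.+1)%N -> #|[pred r : 'I_n.+2 | (1 <= r <= h)%N]| = h.
Proof.
move=> hn; transitivity #|[set (inord i.+1 : 'I_n.+2) | i : 'I_h]|; last first.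
  rewrite card_imset ?card_ord // => i j /(congr1 val) /=.
  have := ltn_ord i; have := ltn_ord j => jh ih.
  by rewrite !inordK; try lia; case=> /val_inj.
apply: eq_card => r; rewrite !inE; apply/idP/imsetP => [/andP[r1 rh]|[i _ ->]].
  have rh' : (r.-1 < h)%N by lia.
  exists (Ordinal rh') => //; apply: ord_inj; rewrite inordK /=; lia.
by have ih := ltn_ord i; rewrite inordK; lia.
Qed.

Section BlockWeight.
Variables (n : nat) (Gam : graph n) (i j : nat) (v0 : 'I_n.+1) (Q : {set 'I_n.+1}).
Implicit Types (c : comp_triple n) (S : {set comp_triple n}) (B : {set 'I_n.+1}).

Definition elem_poly (k : nat) : {poly series} := (elem k)%:P.

Definition block_weight B : {poly series} :=
  if (v0 \in B) ==> (Q \subset B) then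
    connected_poly series (edges Gam) B
    * comp_sum elem_poly (ord0 \in B) (v0 \in B) i j #|B|
  else 0.

(** The conditions defining [restricted_triples], imposed on each triple separately so that the
    weight of $\mathcal S$ becomes a product. *)
Definition triple_cond c :=
  [&& is_comp_triple Gam c,
      (ord0 \in ct_verts c) ==> (head 0%N (ct_comp c) == i) && (ct_root c == 1%N :> nat)
    & (v0 \in ct_verts c) ==> (Q \subset ct_verts c) && (j < last 0 (ct_comp c))%N].

(* Omitting the first part at vertex 1 turns the type into the reduced type. *)
Definition free_parts c : seq nat :=
  if ord0 \in ct_verts c then behead (ct_comp c) else ct_comp c.

Definition triple_weight c : {poly series} :=
  if triple_cond c then
    (-1) ^+ (#|ct_verts c| + size (ct_comp c)) * 'X^#|ct_edges c|
    * \prod_(k <- free_parts c) elem_poly k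
  else 0.

Lemma sum_triple_weight B : \sum_(c | ct_verts c == B) triple_weight c = block_weight B.
Proof.
rewrite (reindex_onto
  (fun y : {set {set 'I_n.+1}} * {bseq n.+1 of 'I_n.+2} * 'I_n.+2 =>
     CompTriple B y.1.1 y.1.2 y.2)
  (fun c => (ct_edges c, ct_parts c, ct_root c))) /=; last first.
  by case=> V E a r /= /eqP ->.
rewrite (eq_bigl xpredT) => [|[[E a] r]]; last by rewrite /= !eqxx.
rewrite -(pair_bigA _ (fun x r => triple_weight (CompTriple B x.1 x.2 r))) /=.
rewrite -(pair_bigA _ (fun E a => \sum_r triple_weight (CompTriple B E a r))) /=.
set f := ord0 \in B; set l := v0 \in B.
pose F (a : seq nat) := if l ==> (j < last 0 a)%N
  then (-1) ^+ (#|B| + size a) * comp_weight elem_poly f i a else 0.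
(* With edges and composition fixed, only the root varies: there are [head 0 a] choices, or, in the
   block of vertex 1, the single choice 1 when the first part is [i]. *)
have sum_r (E : {set {set 'I_n.+1}}) (a : {bseq n.+1 of 'I_n.+2}) :
    \sum_r triple_weight (CompTriple B E a r) =
    if ((v0 \in B) ==> (Q \subset B)) && ((E \subset edges Gam) && connected_on E B)
       && is_comp_of #|B| (map val a)
    then 'X^#|E| * F (map val a) else 0.
  rewrite /triple_weight /triple_cond /is_comp_triple /ct_comp /=.
  have -> : is_connected_subgraph Gam B E = (E \subset edges Gam) && connected_on E B.
    by rewrite /is_connected_subgraph /connected_on andbCA.
  case: (boolP ((E \subset edges Gam) && connected_on E B)) => [EB|]; last first.
    by rewrite andbF /= => _; rewrite big1.
  rewrite /= andbT; case: (boolP (is_comp_of #|B| (map val a))) => [aB|]; last first.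
    by rewrite andbF /= => _; rewrite big1.
  rewrite /= andbT.
  have B0 : B != set0 by case/andP: EB => _ /and3P[].
  set h := head 0%N _; set C := _ * _.
  have [h1 hn] : (0 < h)%N /\ (h <= n.+1)%N.
    have hB x : x \in map val a -> (x <= n.+1)%N.
      move=> /(part_comp_leq aB) /leq_trans; apply.
      by have := max_card B; rewrite card_ord.
    case/andP: aB; move: hB; rewrite /h; case: (map val a) => /= [_ _|x s hB /andP[x1 _] _].
      by rewrite eq_sym cards_eq0 (negbTE B0).
    by split=> //; apply: hB; rewrite mem_head.
  have lQj : l ==> (Q \subset B) && (j < last 0 (map val a))%N =
      (l ==> (Q \subset B)) && (l ==> (j < last 0 (map val a))%N) by case: (l).
  rewrite -/l lQj; case: (boolP (l ==> (Q \subset B))) => _; last first.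
    by rewrite big1 // => r _; rewrite !andbF.
  rewrite /F; case: (boolP (l ==> _)) => _; last first.
    by rewrite mulr0 big1 // => r _; rewrite !andbF.
  rewrite -big_mkcond /=.
  transitivity (\sum_(r in [pred r : 'I_n.+2 | (1 <= r <= h)%N
        && (f ==> (h == i) && (r == 1%N :> nat))])
      C * \prod_(k <- if f then behead (map val a) else map val a) elem_poly k).
    by apply: eq_bigl => r; rewrite inE andbT.
  rewrite sumr_const -mulr_natr /comp_weight -/h {}/C; case: (boolP f) => /= _.
    rewrite [X in _ * X%:R = _](_ : _ = (h == i) :> nat); first exact: mulr_swap4.
    case: (h == i); last by apply: eq_card0 => r; rewrite !inE andbF.
    apply: (eq_card1 (x := inord 1)) => r; rewrite !inE -val_eqE /= inordK //.
    by apply/andP/idP => [[] //|/eqP->]; rewrite h1.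
  rewrite [X in _ * X%:R = _](_ : _ = h); first exact: mulr_swap4.
  by rewrite -[RHS](card_roots hn); apply: eq_card => r; rewrite !inE andbT.
under eq_bigr => E _ do under eq_bigr => a _ do rewrite sum_r.
rewrite /block_weight -/l; case: (boolP (l ==> _)) => lQ; last first.
  by rewrite big1 // => E _; rewrite big1.
rewrite /connected_poly big_distrl /= [RHS]big_mkcond; apply: eq_bigr => E _ /=.
case: ifP => EB; last by rewrite big1.
rewrite /= -big_mkcond /= -big_distrr /=; congr (_ * _).
rewrite (sum_bounded_comps F); last by rewrite -[X in (_ <= X)%N]card_ord max_card.
by rewrite /F /comp_sum [RHS]big_mkcond.
Qed.

End BlockWeight.

Lemma comp_atP n (S : {set comp_triple n}) U c v :
  packing (@ct_verts n) U S -> c \in S -> v \in ct_verts c -> comp_at S v = c.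
Proof.
move=> /packingP[_ dis _] cS vc; rewrite /comp_at; case: pickP => [d /andP[dS vd]|/(_ c)] /=.
  exact: dis dS cS vd vc.
by rewrite cS vc.
Qed.

Section PackingStatistics.
Variables (n : nat) (S : {set comp_triple n}).
Hypothesis packS : packing (@ct_verts n) setT S.
Hypothesis compS : forall c, c \in S -> is_comp_of #|ct_verts c| (ct_comp c).

Lemma comp_at_mem v : comp_at S v \in S /\ v \in ct_verts (comp_at S v).
Proof.
have /packingP[_ _ cov] := packS; have [c cS vc] := (cov v).1 (in_setT _).
by rewrite (comp_atP packS cS vc).
Qed.

Lemma sum_card_verts : (\sum_(c in S) #|ct_verts c|)%N = n.+1.
Proof.
have /packingP[_ dis cov] := packS.
rewrite -[RHS]card_ord -sum1_card.
under eq_bigr do rewrite -sum1_card.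
rewrite (exchange_big_dep xpredT) //=; apply: eq_bigr => v _.
have [cS vc] := comp_at_mem v.
rewrite (big_pred1 (comp_at S v)) // => c /=.
apply/andP/eqP => [[cS' vc']|->] //; exact: dis cS' cS vc' vc.
Qed.

Lemma perm_st_type : perm_eq (st_type S) (flatten [seq ct_comp c | c <- enum S]).
Proof. by rewrite /st_type perm_sort. Qed.

Lemma size_st_type : size (st_type S) = (\sum_(c in S) size (ct_comp c))%N.
Proof.
by rewrite (perm_size perm_st_type) size_flatten /shape -map_comp sumnE big_map big_enum.
Qed.

(** The block sizes add up to $N$, so $N-\ell$ and the sum of the local exponents have the same
    parity; the subtraction is exact because a composition has at most as many parts as its size. *)
Lemma st_signE (R : pzRingType) :
  (st_sign S)%:~R = \prod_(c in S) (-1) ^+ (#|ct_verts c| + size (ct_comp c)) :> R.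
Proof.
rewrite /st_sign rmorphXn rmorphN1 prodrXr.
have le_n : (size (st_type S) <= n.+1)%N.
  rewrite size_st_type -sum_card_verts; apply: leq_sum => c cS.
  exact: size_comp_leq (compS cS).
rewrite big_split /= sum_card_verts -size_st_type.
by rewrite -[LHS]signr_odd -[RHS]signr_odd oddB // oddD.
Qed.

Lemma elem_seq_rtype :
  (elem_seq (st_rtype S))%:P = \prod_(c in S) \prod_(k <- free_parts c) elem_poly k.
Proof.
have [cS vc] := comp_at_mem ord0; have /packingP[_ dis cov] := packS.
rewrite /st_rtype; set c := comp_at S ord0 in cS vc *.
have cE : c \in enum S by rewrite mem_enum.
rewrite -big_enum (perm_big _ (perm_to_rem cE)) big_cons /=.
have free_rem : {in rem c (enum S), forall d, free_parts d = ct_comp d}.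
  move=> d; rewrite (rem_filter _ (enum_uniq _)) mem_filter mem_enum => /andP[/= dc dS].
  rewrite /free_parts; case: ifP => // vd.
  by rewrite (dis _ _ _ dS cS vd vc) eqxx in dc.
have -> : \prod_(d <- rem c (enum S)) \prod_(k <- free_parts d) elem_poly k =
    \prod_(d <- rem c (enum S)) \prod_(k <- ct_comp d) elem_poly k.
  by apply: eq_big_seq => d /free_rem ->.
rewrite /free_parts vc.
set rest := flatten [seq ct_comp d | d <- rem c (enum S)].
have -> : elem_seq (rem (head 0%N (ct_comp c)) (st_type S)) =
    elem_seq (behead (ct_comp c) ++ rest).
  apply: perm_big.
  have perm_t : perm_eq (st_type S) (ct_comp c ++ rest).
    apply: perm_trans perm_st_type _.
    exact: perm_flatten (perm_map _ (perm_to_rem cE)).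
  have : ct_comp c != [::].
    apply/eqP => c0; have := compS cS; rewrite c0 /is_comp_of /= eq_sym cards_eq0 => /eqP c00.
    by rewrite c00 inE in vc.
  case: (ct_comp c) perm_t => //= h t perm_t _.
  have hS : h \in st_type S by rewrite (perm_mem perm_t) mem_head.
  by rewrite -(perm_cons h) -(permPl (perm_to_rem hS)).
rewrite /elem_seq big_cat /= polyCM !rmorph_prod; congr (_ * _).
by rewrite big_flatten big_map.
Qed.

End PackingStatistics.

Section TutteEntry.
Variables (p j : nat) (G : graph p).

Definition path_verts : {set 'I_(p + j).+1} := [set v : 'I_(p + j).+1 | (p <= v)%N].

Local Notation w := (ord_wedge (erefl (p + j)%N)).

Lemma mem_path_verts_r b : wr w b \in path_verts.
Proof. by rewrite inE /= ord_rE ?leq_addl. Qed.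

Lemma glue_vertexE : wl w ord_max = inord p.
Proof. by []. Qed.

(* Hence the exponent [st_edges S - j] in [Tutte_entry] is not truncated. *)
Lemma path_edges_leq (E : {set {set 'I_(p + j).+1}}) (B : {set 'I_(p + j).+1}) :
  E \subset edges (sum_graph G (path_graph j)) -> connected_on E B ->
  path_verts \subset B -> (j <= #|E|)%N.
Proof.
move=> + con QB; have rB b : wr w b \in B by exact: subsetP QB _ (mem_path_verts_r b).
move=> /(wedge_edges_split (w := w))[E1 [E2 [sub1 sub2 EE]]].
have lB : wl w ord_max \in B by rewrite (w_glue w).
move: con; rewrite EE -(wunion_preim w B) connected_wunion ?inE //.
rewrite (_ : wr w @^-1: B = setT) => [/andP[_]|];
  last by apply/setP => b; rewrite in_setT inE; exact: rB.
(* The right part of [E] connects the whole path, so it consists of all [j] path edges. *)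
rewrite connected_path // => /eqP eE2.
rewrite -{1}(card_path_edges j) -eE2 -(card_imset _ (imset_inj (wr_inj (w := w)))).
exact/subset_leq_card/subsetUr.
Qed.

Lemma restricted_triplesE i S :
  (S \in restricted_triples G i j.+1) =
  packing (@ct_verts _) setT S &&
  [forall c in S, triple_cond (sum_graph G (path_graph j)) i j (inord p) path_verts c].
Proof.
set Gam := sum_graph _ _; rewrite inE.
have -> : (S \in subgraph_triples Gam) =
    packing (@ct_verts _) setT S && [forall c in S, is_comp_triple Gam c].
  rewrite inE /packing; apply/and3P/andP => [[cS -> ->]|[/and3P[_ -> ->] ->] //].
  split=> //; rewrite !andbT; apply/forall_inP => c /(forall_inP cS).
  by case/and3P => /and4P[].
rewrite -andbA; apply: andb_id2l => packS.
have [c0S v0] := comp_at_mem packS ord0; have [c1S v1] := comp_at_mem packS (inord p).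
set c0 := comp_at S ord0 in c0S v0 *; set c1 := comp_at S (inord p) in c1S v1 *.
have QE c : [forall v : 'I_(p + j).+1, (p <= v)%N ==> (v \in ct_verts c)] =
    (path_verts \subset ct_verts c).
  by apply/forallP/subsetP => sub v; [rewrite inE => pv; exact: implyP (sub v) pv|
    apply/implyP => pv; apply: sub; rewrite inE].
apply/andP/forall_inP => [[/forall_inP tS /and4P[hi r1 Qc jl]] c cS|cond].
  rewrite /triple_cond tS //=; apply/andP; split; apply/implyP => vc.
    by rewrite -(comp_atP packS cS vc) hi.
  by rewrite -(comp_atP packS cS vc) -QE Qc.
split; first by apply/forall_inP => c /cond /and3P[].
have /and3P[_ + _] := cond _ c0S; have /and3P[_ _] := cond _ c1S.
rewrite v0 v1 /= QE => /andP[-> jl] /andP[-> ->] //=.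
Qed.

(** Multiplying by ['X^j] turns the exponent [st_edges S - j] into [st_edges S], which is additive
    over components. Later uses cancel ['X^j] because it is monic. *)
Lemma Tutte_entryE i :
  Tutte_entry G i j.+1 * 'X^j =
  (-1) ^+ j * partition_sum
    (block_weight (sum_graph G (path_graph j)) i j (inord p) path_verts) setT.
Proof.
set Gam := sum_graph _ _; set tw := triple_weight Gam i j (inord p) path_verts.
rewrite (eq_partition_sum (W := fun B => \sum_(c | ct_verts c == B) tw c)); last first.
  by move=> B _; rewrite sum_triple_weight.
rewrite -packing_sum_blocks /Tutte_entry /packing_sum big_distrl big_distrr /=.
rewrite big_mkcond [RHS]big_mkcond; apply: eq_bigr => S _ /=.
rewrite restricted_triplesE; case: (boolP (packing _ _ _)) => //= packS.
case: (boolP [forall c in S, _]) => [/forall_inP cond|]; last first.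
  rewrite negb_forall_in => /exists_inP[c cS ncond].
  by rewrite (bigD1 c) //= /tw /triple_weight (negbTE ncond) mul0r mulr0.
have compS c : c \in S -> is_comp_of #|ct_verts c| (ct_comp c).
  by case/cond/and3P => /and3P[].
rewrite (st_signE packS compS) (elem_seq_rtype packS compS).
have -> : \prod_(c in S) tw c = \prod_(c in S)
    ((-1) ^+ (#|ct_verts c| + size (ct_comp c)) * 'X^#|ct_edges c|
     * \prod_(k <- free_parts c) elem_poly k).
  by apply: eq_bigr => c cS; rewrite /tw /triple_weight cond.
rewrite !big_split /=.
have jS : (j <= st_edges S)%N.
  have [cS vc] := comp_at_mem packS (inord p).
  have /and3P[/and3P[/and4P[n0 sub eV con] _ _] _] := cond _ cS.
  rewrite vc => /= /andP[QV _]; rewrite /st_edges (bigD1 _ cS) /=.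
  apply: leq_trans (leq_addr _ _).
  by apply: path_edges_leq sub _ QV; rewrite /connected_on n0 eV con.
have -> : \prod_(c in S) 'X^#|ct_edges c| = 'X^(st_edges S - j) * 'X^j :> {poly series}.
  by rewrite prodrXr -exprD subnK.
exact: mulr_swap5.
Qed.

End TutteEntry.

(** * Expansion along the block of the glued vertex *)

Section WedgePartitions.
Variables (T1 T2 T : finType) (x1 : T1) (x2 : T2) (w : wedge T x1 x2).
Variables (R : comNzRingType) (W : {set T} -> R).
Hypothesis sepW : forall (U : {set T}) a b,
  wl w x1 \notin U -> wl w a \in U -> wr w b \in U -> W U = 0.

Lemma partition_sum_wunion (A : {set T1}) (B : {set T2}) : x1 \notin A -> x2 \notin B ->
  partition_sum W (wunion w A B) =
  partition_sum (fun U => W (wl w @: U)) A * partition_sum (fun U => W (wr w @: U)) B.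
Proof.
move=> xA xB; rewrite partition_sum_disjoint.
- by congr (_ * _); apply: partition_sum_imset => //; [exact: wl_inj|exact: wr_inj].
- rewrite -setI_eq0; apply/eqP/setP => z; rewrite !inE; apply/negbTE/negP => /andP[].
  by move=> /imsetP[a aA ->] /imsetP[b _] /wedge_eq[ax _]; rewrite ax (negbTE xA) in aA.
move=> U u v UAB /imsetP[a _ ->] /imsetP[b _ ->] aU bU; apply: sepW aU bU.
apply/negP => /(subsetP UAB).
by rewrite mem_wunion_l ?(negbTE xA) // (negbTE xB).
Qed.

(** Once the block of the glued point is removed, [sepW] forces every remaining block to one side,
    so the remaining sum factors. *)
Lemma partition_sum_wedge :
  partition_sum W setT =
  \sum_(A : {set T1} | x1 \in A) \sum_(B : {set T2} | x2 \in B) W (wunion w A B) *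
    (partition_sum (fun U => W (wl w @: U)) (~: A)
     * partition_sum (fun U => W (wr w @: U)) (~: B)).
Proof.
rewrite (partition_sum_rec _ (in_setT (wl w x1))).
rewrite (eq_bigl (fun U : {set T} => wl w x1 \in U)) => [|U]; last by rewrite subsetT andbT.
rewrite sum_wunion; apply: eq_bigr => A xA; apply: eq_bigr => B xB.
by rewrite setTD setC_wunion // partition_sum_wunion // inE ?xA ?xB.
Qed.

End WedgePartitions.

Section OrdinalWedgePartitions.
Variables (n p q : nat) (npq : n = (p + q)%N).
Local Notation w := (ord_wedge npq).
Variables (G : graph p) (H : graph q) (Gam : graph n).
Hypothesis edgesE : edges Gam = im2 (wl w) (edges G) :|: im2 (wr w) (edges H).
Variables (i j : nat) (v : 'I_q.+1) (Q : {set 'I_q.+1}).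
Implicit Types (A : {set 'I_p.+1}) (B : {set 'I_q.+1}).

Local Notation W := (block_weight Gam i j (wr w v) (wr w @: Q)).

(** Blocks strictly left of the glued vertex miss [wr w v], so they carry no condition on the last
    part. Fixing the column at 0 gives one weight for both $M_G$ and $M_{G+H}$. *)
Definition left_weight A : {poly series} :=
  connected_poly series (edges G) A * comp_sum elem_poly (ord0 \in A) false i 0 #|A|.

Lemma wl_ord0 : ord0 = wl w ord0.
Proof. by apply: ord_inj; rewrite /= (ord_lE npq). Qed.

Lemma subset_wunion_r A B : (ord_max \in A -> ord0 \in B) ->
  (wr w @: Q \subset wunion w A B) = (Q \subset B).
Proof.
move=> AB; apply/subsetP/subsetP => sub b.
  by move=> bQ; rewrite -(mem_wunion_r w (A := A)) //; apply: sub; exact: imset_f.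
by move=> /imsetP[c cQ ->]; rewrite mem_wunion_r // sub.
Qed.

Lemma block_weight_wunion A B : ord_max \in A -> ord0 \in B ->
  W (wunion w A B) =
  if (v \in B) ==> (Q \subset B) then
    connected_poly series (edges G) A * connected_poly series (edges H) B
    * comp_sum elem_poly (ord0 \in A) (v \in B) i j (#|A| + #|B|).-1
  else 0.
Proof.
move=> xA xB; rewrite /block_weight mem_wunion_r // subset_wunion_r // wl_ord0 mem_wunion_l //.
by rewrite card_wunion // edgesE connected_poly_wunion //; exact: edges_card.
Qed.

Lemma wl_imset A : wl w @: A = wunion w A set0.
Proof. by rewrite /wunion imset0 setU0. Qed.

Lemma wr_imset B : wr w @: B = wunion w set0 B.
Proof. by rewrite /wunion imset0 set0U. Qed.

Lemma block_weight_wl A : ord_max \notin A -> W (wl w @: A) = left_weight A.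
Proof.
move=> xA; have vA : wr w v \in wl w @: A = false.
  by rewrite wl_imset mem_wunion_r ?(negbTE xA) // in_set0.
have A0 : (ord0 \in wl w @: A) = (ord0 \in A).
  by rewrite wl_ord0; apply: mem_imset; exact: wl_inj.
rewrite /block_weight /left_weight vA A0 card_imset; last exact: wl_inj.
by rewrite edgesE connected_poly_wl //; exact: edges_card.
Qed.

(** Such a block misses vertex 1 of the glued graph and vertex 1 of [H], so it has the same weight
    for every row, and row 0 is taken as representative. *)
Lemma block_weight_wr B : ord0 \notin B -> W (wr w @: B) = block_weight H 0 j v Q B.
Proof.
move=> xB; have vB : (wr w v \in wr w @: B) = (v \in B).
  by apply: mem_imset; exact: wr_inj.
have B0 : ord0 \in wr w @: B = false.
  by rewrite wl_ord0 wr_imset mem_wunion_l ?(negbTE xB) // in_set0.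
rewrite /block_weight vB B0 (negbTE xB) subset_imset_inj; last exact: wr_inj.
rewrite card_imset; last exact: wr_inj.
by rewrite edgesE connected_poly_wr //; exact: edges_card.
Qed.

Lemma partition_sum_ord_wedge :
  partition_sum W setT =
  \sum_(A : {set 'I_p.+1} | ord_max \in A) \sum_(B : {set 'I_q.+1} | ord0 \in B)
    W (wunion w A B) *
    (partition_sum left_weight (~: A) * partition_sum (block_weight H 0 j v Q) (~: B)).
Proof.
rewrite (partition_sum_wedge (w := w)) => [|U a b xU aU bU].
  apply: eq_bigr => A xA; apply: eq_bigr => B xB; congr (_ * (_ * _)).
    apply: eq_partition_sum => U /subsetP sub; apply: block_weight_wl.
    by apply/negP => /sub; rewrite inE xA.
  apply: eq_partition_sum => U /subsetP sub; apply: block_weight_wr.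
  by apply/negP => /sub; rewrite inE xB.
rewrite /block_weight edgesE [X in X * _](_ : _ = 0) ?mul0r ?if_same //.
by apply: connected_poly_sep xU aU bU; exact: edges_card.
Qed.

End OrdinalWedgePartitions.

Lemma path_vertsE p j : path_verts p j = wr (ord_wedge (erefl (p + j)%N)) @: setT.
Proof.
apply/setP => u; apply/idP/imsetP => [|[b _ ->]]; last exact: mem_path_verts_r.
rewrite inE => pu; have [[a ua]|[b ->]] := w_cover (ord_wedge (erefl (p + j)%N)) u;
  last by exists b.
exists ord0 => //; rewrite -w_glue ua; congr (wl _ _).
by apply: ord_inj; move: pu; rewrite ua /= (ord_lE (erefl (p + j)%N)) /=; have := ltn_ord a; lia.
Qed.

Lemma path_verts_assoc p q j :
  path_verts (p + q) j = wr (ord_wedge (esym (addnA p q j))) @: path_verts q j.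
Proof.
apply/setP => u; rewrite inE; apply/idP/imsetP => [pu|[b]].
  exists (ord_pr p (q + j) u).
    by rewrite inE (ord_prE (esym (addnA p q j))); lia.
  by apply: ord_inj; rewrite /= (ord_rE (esym (addnA p q j))) (ord_prE (esym (addnA p q j))); lia.
by rewrite inE => qb ->; rewrite /= (ord_rE (esym (addnA p q j))); lia.
Qed.

Lemma card_path_verts p j : #|path_verts p j| = j.+1.
Proof. by rewrite path_vertsE card_imset ?cardsT ?card_ord //; exact: wr_inj. Qed.

(** * Entries of $M_G$, $M_H$ and $M_{G+H}$ expanded at the glued vertex *)

Section TutteFormulas.
Variables (p q : nat) (G : graph p) (H : graph q).

Lemma Tutte_entry_left i k :
  Tutte_entry G i k.+1 =
  (-1) ^+ k * \sum_(A : {set 'I_p.+1} | ord_max \in A)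
    connected_poly series (edges G) A
    * comp_sum elem_poly (ord0 \in A) true i k (#|A| + k)
    * partition_sum (left_weight G i) (~: A).
Proof.
apply: (monic_rreg (monicXn _ k)); rewrite Tutte_entryE -mulrA; congr (_ * _).
have eG := sum_edges_wedge G (path_graph k).
rewrite -glue_vertexE (w_glue (ord_wedge (erefl (p + k)%N))) path_vertsE.
rewrite (partition_sum_ord_wedge eG) big_distrl; apply: eq_bigr => A xA /=.
(* The block of the glued vertex must contain the whole path, so only [B = setT] survives; its path
   factor ['X^k] is the one to cancel. *)
rewrite (bigD1 setT) ?in_setT //= big1 => [|B /andP[xB BT]]; last first.
  by rewrite (block_weight_wunion eG) // xB subTset (negbTE BT) mul0r.
rewrite addr0 (block_weight_wunion eG) ?in_setT // subsetT /= setCT.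
rewrite [X in _ * (_ * X)]packing_sum0 mulr1 cardsT card_ord connected_poly_path addnS /=.
by rewrite -!mulrA; congr (_ * _); rewrite mulrC -mulrA.
Qed.

(** Here the expansion is along the block of vertex 1 of [H], the vertex glued to [G]. The other
    blocks do not see the row, so the sum over [k] will affect only that block. *)
Lemma Tutte_entry_right k j :
  Tutte_entry H k.+1 j.+1 * 'X^j =
  (-1) ^+ j * \sum_(B : {set 'I_(q + j).+1} | ord0 \in B)
    block_weight (sum_graph H (path_graph j)) k.+1 j (inord q) (path_verts q j) B
    * partition_sum
        (block_weight (sum_graph H (path_graph j)) 0 j (inord q) (path_verts q j)) (~: B).
Proof.
rewrite Tutte_entryE; congr (_ * _); rewrite (partition_sum_rec _ (in_setT ord0)).
apply: eq_big => [B|B /andP[xB _]]; first by rewrite subsetT andbT.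
rewrite setTD; congr (_ * _); apply: eq_partition_sum => U /subsetP sub.
have xU : ord0 \notin U by apply/negP => /sub; rewrite inE xB.
by rewrite /block_weight (negbTE xU).
Qed.

Lemma Tutte_entry_sum i j :
  Tutte_entry (sum_graph G H) i j.+1 * 'X^j =
  (-1) ^+ j * \sum_(A : {set 'I_p.+1} | ord_max \in A)
    \sum_(B : {set 'I_(q + j).+1} | ord0 \in B)
    (if (inord q \in B) ==> (path_verts q j \subset B) then
       connected_poly series (edges G) A
       * connected_poly series (edges (sum_graph H (path_graph j))) B
       * comp_sum elem_poly (ord0 \in A) (inord q \in B) i j (#|A| + #|B|).-1
     else 0) *
    (partition_sum (left_weight G i) (~: A) *
     partition_sum
       (block_weight (sum_graph H (path_graph j)) 0 j (inord q) (path_verts q j)) (~: B)).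
Proof.
rewrite Tutte_entryE; congr (_ * _).
have eG := sum_graph_assoc_edges G H (path_graph j).
rewrite path_verts_assoc.
have -> : inord (p + q) = wr (ord_wedge (esym (addnA p q j))) (inord q).
  by apply: ord_inj; rewrite /= (ord_rE (esym (addnA p q j))) !inordK; lia.
rewrite (partition_sum_ord_wedge eG); apply: eq_bigr => A xA; apply: eq_bigr => B xB.
by rewrite (block_weight_wunion eG).
Qed.

End TutteFormulas.

(** * The matrix product *)

Lemma infmx_mulE (R : pzRingType) (A B : nat -> nat -> R) i j m :
  (forall k, (m <= k)%N -> B k j = 0) -> infmx_mul A B i j = \sum_(k < m) A i k * B k j.
Proof.
move=> B0; rewrite /infmx_mul (fsbigE _ _ (iota_uniq 0 m)) //=; last first.
  by move=> k _; rewrite mem_iota /= -leqNgt => mk; rewrite B0 ?mulr0.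
rewrite -[m in iota 0 m]subn0 -/(index_iota 0 m) big_mkord.
by apply: eq_bigl => k; apply/mem_set.
Qed.

Theorem proposition3p7 (p q : nat) (G : graph p) (H : graph q) :
  Tutte_mx (sum_graph G H) = infmx_mul (Tutte_mx G) (Tutte_mx H).
Proof.
apply/funext => i; apply/funext => j.
(* Column [j] of [Tutte_mx H] vanishes from row [(q + j).+1] on. This is also the number of vertices
   of $H+P_{j+1}$, hence a bound on [#|B|] as required of [K] in [comp_sum_glue]. *)
rewrite (@infmx_mulE _ _ _ i j (q + j).+1) => [|k]; last exact: Tutte_mx_eq0.
apply: (monic_rreg (monicXn _ j)); rewrite /Tutte_mx Tutte_entry_sum big_distrl /=.
under [RHS]eq_bigr do rewrite -mulrA Tutte_entry_right Tutte_entry_left mulrCA.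
rewrite -big_distrr; congr (_ * _) => /=.
under [RHS]eq_bigr do rewrite -mulrA big_distrlr big_distrr /=.
rewrite [RHS]exchange_big /=; apply: eq_bigr => A xA.
under [RHS]eq_bigr do rewrite big_distrr /=.
rewrite [RHS]exchange_big /=; apply: eq_bigr => B xB.
rewrite /block_weight xB; case: ifP => cond; last first.
  by rewrite mul0r big1 // => k _; rewrite mul0r !mulr0.
(* All factors now agree except the composition sums of the block of the glued vertex, with sizes
   [#|A|] and [#|B|]. *)
rewrite (@comp_sum_glue _ _ _ _ _ _ _ _ (q + j).+1).
- rewrite big_distrr big_distrl; apply: eq_bigr => k _ /=; exact: mulr_swap7.
- by apply/card_gt0P; exists ord_max.
- by apply/card_gt0P; exists ord0.
- by rewrite -[X in (_ <= X)%N]card_ord max_card.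
(* When [B] meets the end of [H] it contains all [j.+1] path vertices, which gives [j < #|B|]. *)
- by move=> vB; rewrite -(card_path_verts q j) subset_leq_card //; exact: implyP cond vB.
Qed.
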